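(* Let $a>0$, $\Omega_0:=\mathbb{R}\times(-a,a)$, and let $H_0=-\Delta_D^{\Omega_0}$ be the Dirichlet Laplacian in $L^2(\Omega_0)$. Then $H_0$ is critical, i.e. for every real-valued $V\in C_0^\infty(\Omega_0)$ with $V\le0$ and $V\ne0$, $$\inf\sigma(H_0+V)<\inf\sigma(H_0).$$
   Context: $\sigma(\cdot)$ denotes the spectrum. (Here $\inf\sigma(H_0)=E_1:=(\pi/(2a))^2$.) *)

(* Defs.v *)
From HB Require Import structures.
From mathcomp Require Import all_boot all_order all_algebra.
From mathcomp Require Import complex.
From mathcomp Require Import all_classical all_reals all_analysis.

Set Implicit Arguments.
Unset Strict Implicit.
Unset Printing Implicit Defensive.

Import Order.TTheory GRing.Theory Num.Theory.
Import numFieldNormedType.Exports.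

Local Open Scope classical_set_scope.
Local Open Scope ring_scope.
Local Open Scope complex_scope.

Section SmoothFunctions.
Context {R : realType}.
Implicit Types (D : set (R * R)) (f : R * R -> R) (phi : R * R -> R[i]).

(* The two coordinate directions of the plane are indexed by [bool]. *)
Definition axis (j : bool) : R * R := if j then (0, 1) else (1, 0).

Definition pderiv (j : bool) f : R * R -> R := fun p => 'D_(axis j) f p.

Definition smooth f : Prop :=
  forall (s : seq bool) (p : R * R), differentiable (foldr pderiv f s) p.

(* C_0^oo(D): functions on D are identified with their extension by 0. *)
Definition test_function D f : Prop :=
  smooth f /\
  exists K : set (R * R),
    [/\ compact K, K `<=` D & forall p, ~ K p -> f p = 0].

Definition ctest_function D phi : Prop :=
  test_function D (fun p => complex.Re (phi p)) /\
  test_function D (fun p => complex.Im (phi p)).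

Definition cpderiv (j : bool) phi : R * R -> R[i] :=
  fun p => pderiv j (fun q => complex.Re (phi q)) p
           +i* pderiv j (fun q => complex.Im (phi q)) p.

End SmoothFunctions.

Section SquareIntegrable.
Context {R : realType}.
Implicit Types (D : set (R * R)) (u v : R * R -> R[i]).

Definition lebesgue2 :
    {measure set (measurableTypeR R * measurableTypeR R) -> \bar R} :=
  (@lebesgue_measure R \x @lebesgue_measure R)%E.

Definition cintegral D u : R[i] :=
  (\int[lebesgue2]_(p in D) complex.Re (u p))%R
  +i* (\int[lebesgue2]_(p in D) complex.Im (u p))%R.

Definition sqnorm D u : \bar R :=
  (\int[lebesgue2]_(p in D) ((Normc.normc (u p)) ^+ 2)%:E)%E.

(* Representatives of the elements of the complex space L^2(D); only the
   values on D matter, and a.e. equal functions represent the same element. *)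
Definition L2 D u : Prop :=
  [/\ measurable_fun D (fun p => complex.Re (u p)),
      measurable_fun D (fun p => complex.Im (u p))
    & (sqnorm D u < +oo)%E].

Definition inner D u v : R[i] := cintegral D (fun p => u p * (v p)^*%C).

End SquareIntegrable.

Section DirichletLaplacian.
Context {R : realType}.
Implicit Types (D : set (R * R)) (u v f : R * R -> R[i]).
Implicit Types (g w : bool -> R * R -> R[i]).

Definition weak_pderiv D (j : bool) u v : Prop :=
  forall phi, ctest_function D phi ->
    cintegral D (fun p => u p * cpderiv j phi p) =
    - cintegral D (fun p => v p * phi p).

(* [sobolev D u g]: u belongs to H^1(D) and has weak gradient g. *)
Definition sobolev D u g : Prop :=
  L2 D u /\ forall j, L2 D (g j) /\ weak_pderiv D j u (g j).

(* [sobolev0 D u g]: u belongs to H^1_0(D), the closure of C_0^oo(D) in the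
   H^1(D) norm, and has weak gradient g. *)
Definition sobolev0 D u g : Prop :=
  sobolev D u g /\
  exists phi : nat -> R * R -> R[i],
    (forall n, ctest_function D (phi n)) /\
    ((fun n => (sqnorm D (fun p => (phi n p - u p)%R)
       + \sum_(j : bool) sqnorm D (fun p => (cpderiv j (phi n) p - g j p)%R))%E)
      @ \oo --> 0%E).

(* A linear operator in L^2(D) is given by its graph: [H u f] means that u is
   in the domain of H and H u = f. *)
Definition operator : Type :=
  (R * R -> R[i]) -> (R * R -> R[i]) -> Prop.

(* The self-adjoint operator associated (first representation theorem) with
   the form (u, v) |-> <grad u, grad v> with form domain H^1_0(D). *)
Definition dirichlet_laplacian D : operator := fun u f =>
  L2 D f /\
  exists g, sobolev0 D u g /\
    forall v w, sobolev0 D v w ->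
      \sum_(j : bool) inner D (g j) (w j) = inner D f v.

(* H + V, where V acts by multiplication; its domain consists of the u in the
   domain of H such that V u is in L^2(D). *)
Definition add_potential D (H : operator) (V : R * R -> R) : operator :=
  fun u f => L2 D f /\ H u (fun p => f p - (V p)%:C * u p).

(* z is in the resolvent set when H - z is a bijection from the domain of H
   onto L^2(D) with bounded inverse. *)
Definition resolvent_set D (H : operator) : set R[i] :=
  [set z | exists M : R, forall f, L2 D f ->
    exists u, [/\ H u (fun p => f p + z * u p),
      (sqnorm D u <= M%:E * sqnorm D f)%E
      & forall v, H v (fun p => f p + z * v p) ->
          {ae lebesgue2, forall p, D p -> v p = u p}]].

Definition spectrum D (H : operator) : set R[i] := ~` resolvent_set D H.

(* inf sigma(H) in the extended reals, for H self-adjoint: sigma(H) is then a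
   subset of the real line, hence equal to its set of real points. *)
Definition inf_spectrum D (H : operator) : \bar R :=
  ereal_inf [set x%:E | x in [set x : R | spectrum D H x%:C]].

Definition strip (a : R) : set (R * R) := [set p | - a < p.2 < a].

End DirichletLaplacian.

(* Main.v *)
Require Import Defs.
From mathcomp Require Import all_boot all_order all_algebra.
From mathcomp Require Import complex.
From mathcomp Require Import all_classical all_reals all_analysis.
From mathcomp Require Import measurable_realfun.
From mathcomp Require Import ring lra.

(* With E = (pi / 2a)^2, the Dirichlet form satisfies q0 >= E |.|^2 by
   integrating Jacobi's identity for the ground state cos (pi y / 2a) along
   vertical slices, so every x < E is in the resolvent set of H0, by Riesz
   representation on H^1_0.  The infimum of the Rayleigh quotient of H0 + V
   belongs to the spectrum of H0 + V, and it is smaller than E: for trial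
   functions phi = cos (pi y / 2a) psi with psi = chi (x) eta (y), the energy
   excess is the integral of cos^2 |grad psi|^2 + V phi^2.  Letting psi tend to 1
   slowly in x, and in a thin layer near the boundary in y, where the cosine
   is small, makes the first term vanish, while the second one stays at the
   negative value given by V cos^2. *)

Set Implicit Arguments.
Unset Strict Implicit.
Unset Printing Implicit Defensive.

Import Order.TTheory GRing.Theory Num.Theory.
Import numFieldNormedType.Exports.

Local Open Scope classical_set_scope.
Local Open Scope ring_scope.
Local Open Scope complex_scope.

(** * Riesz representation *)

(** Each spectrum is bounded from one side only: from below for H0, from above for H0 + V. Neither
    an eigenvalue nor the spectral theorem enters. Since the Dirichlet form and V are real, every
    complex equation splits into two real ones, and the Hilbert space arguments are run on real
    triples made of a function and its two derivatives. Criticality comes from the strip being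
    unbounded in a single direction: descending from 1 to 0 over a length r has slope of order 1/r
    and costs an energy of order 1/r, so functions constant in x are approached at vanishing cost.
    The cutoff in y is needed because the cosine, although it vanishes on the boundary, is not
    compactly supported in the strip. Over a width e this cutoff has slope of order 1/e, but the
    cosine is of order e there; the product stays bounded and the cost is proportional to the area r
    e of the layers. Hence r is fixed before e. *)

Lemma discriminant_le (R : realFieldType) (a b c : R) :
  0 <= c -> (forall t : R, 0 <= a + 2 * t * b + t ^+ 2 * c) -> b ^+ 2 <= a * c.
Proof.
move=> c0 h; have [c_eq0|cn0] := eqVneq c 0.
  have [->|b0] := eqVneq b 0; first by rewrite c_eq0 expr0n mulr0.
  (* With no quadratic term the expression is affine in t; this t makes it equal to -1. *)
  have := h (- (a + 1) / (2 * b)); rewrite c_eq0 mulr0 addr0.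
  rewrite (_ : a + _ = -1) ?ler0N1//.
  by field.
have := h (- b / c).
have -> : a + 2 * (- b / c) * b + (- b / c) ^+ 2 * c = (a * c - b ^+ 2) / c.
  by field.
by rewrite pmulr_lge0 ?subr_ge0// invr_gt0 lt_neqAle eq_sym cn0.
Qed.

(** Cauchy-Schwarz bounds squares, so an identity obtained by density arrives in this form, with x
    the difference of its two sides. *)
Lemma sqr_arbitrarily_small (R : archiRealFieldType) (x C : R) : 0 <= C ->
  (forall e : R, 0 < e -> x ^+ 2 <= C * e) -> x = 0.
Proof.
move=> C0 h; apply/eqP; rewrite -sqrf_eq0; apply/eqP/le_anti.
rewrite sqr_ge0 andbT; apply/ler_addgt0Pl => e e0; rewrite addr0.
apply: (le_trans (h (e / (C + 1)) _)); first by rewrite divr_gt0// ltr_wpDl.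
rewrite mulrA ler_pdivrMr ?ltr_wpDl// mulrC ler_pM2l//; lra.
Qed.

Section Riesz.
Context {R : realType} {X : Type}.
(* [comb t x y] stands for x + t y: only affine combinations are needed, and
   no identification of vectors at distance 0. *)
Variables (comb : R -> X -> X -> X) (S : X -> Prop) (B : X -> X -> R).
Hypothesis S_comb : forall t x y, S x -> S y -> S (comb t x y).
Hypothesis BC : forall x y, S x -> S y -> B x y = B y x.
Hypothesis B_comb : forall t x y z, S x -> S y -> S z ->
  B (comb t x y) z = B x z + t * B y z.
Hypothesis B_ge0 : forall x, S x -> 0 <= B x x.

Lemma form_comb_sqr t x y : S x -> S y ->
  B (comb t x y) (comb t x y) = B x x + 2 * t * B x y + t ^+ 2 * B y y.
Proof.
move=> Sx Sy; have Sc := S_comb t Sx Sy.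
rewrite B_comb// (BC Sx Sc) (BC Sy Sc) !B_comb// (BC Sy Sx); ring.
Qed.

Lemma form_cauchy_schwarz x y : S x -> S y -> B x y ^+ 2 <= B x x * B y y.
Proof.
move=> Sx Sy; apply: discriminant_le; first exact: B_ge0.
by move=> t; rewrite -form_comb_sqr//; apply: B_ge0; exact: S_comb.
Qed.

(* The representing vector is the limit of a minimizing sequence of
   J x = B x x - 2 l x, which is Cauchy by the parallelogram law. *)
Lemma riesz_representation (l : X -> R) (C : R) (x0 : X) : S x0 ->
  (forall t x y, S x -> S y -> l (comb t x y) = l x + t * l y) ->
  0 <= C -> (forall x, S x -> l x ^+ 2 <= C * B x x) ->
  (forall x_ : nat -> X, (forall n, S (x_ n)) ->
    (forall e : R, 0 < e -> exists N, forall m n, (N <= m)%N -> (N <= n)%N ->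
      B (comb (-1) (x_ m) (x_ n)) (comb (-1) (x_ m) (x_ n)) <= e) ->
    exists x, S x /\ forall e : R, 0 < e -> exists N, forall n, (N <= n)%N ->
      B (comb (-1) (x_ n) x) (comb (-1) (x_ n) x) <= e) ->
  exists u, S u /\ forall v, S v -> B u v = l v.
Proof.
move=> Sx0 l_comb C0 lB complete.
pose J x := B x x - 2 * l x.
have J_ge x : S x -> - C <= J x.
  move=> Sx; have h := lB x Sx; have b := B_ge0 Sx; rewrite /J.
  (* Since 4 (l x)^2 <= 4 C B x x <= (B x x + C)^2, the functional [J] is at least - C. *)
  suff : `|2 * l x| <= B x x + C by rewrite ler_norml => /andP[_]; lra.
  rewrite -ler_sqr ?nnegrE ?addr_ge0// real_normK ?num_real//.
  have := sqr_ge0 (B x x - C); rewrite exprMn !expr2 in h *; nra.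
pose E := [set J x | x in S].
have EhI : has_inf E.
  by split; [exists (J x0), x0|exists (- C) => _ [x Sx <-]; exact: J_ge].
pose m := inf E.
have m_le x : S x -> m <= J x by move=> Sx; apply: ge_inf; [exact: EhI.2|exists x].
have /choice[x_ /= x_P] : forall n : nat, exists x, S x /\ J x <= m + n.+1%:R^-1.
  move=> n; have [|_ [x Sx <-] /ltW] := @inf_adherent _ E n.+1%:R^-1 _ EhI.
    by rewrite invr_gt0.
  by exists x.
have Sx_ n : S (x_ n) by case: (x_P n).
have Jx_ n : J (x_ n) <= m + n.+1%:R^-1 by case: (x_P n).
have inv_small (e : R) : 0 < e -> exists N : nat, forall n, (N <= n)%N -> n.+1%:R^-1 <= e.
  move=> e0; have [N N0 hN] := near_infty_natSinv_lt (PosNum e0).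
  by exists N => n Nn; apply/ltW/hN.
have l_shift t x v : S x -> S v ->
    J (comb t x v) = J x + 2 * t * (B x v - l v) + t ^+ 2 * B v v.
  by move=> Sx Sv; rewrite /J form_comb_sqr// l_comb//; ring.
have [|u [Su uP]] := complete x_ Sx_.
  move=> e e0; have [|N NP] := inv_small (e / 4); first by rewrite divr_gt0.
  exists N => i j Ni Nj; have Sd := S_comb (-1) (Sx_ i) (Sx_ j).
  have Sd' := S_comb (-1) (Sx_ j) (Sx_ i).
  (* This is the midpoint of [x_ i] and [x_ j]. There [J] is the mean of the two values minus a
     quarter of the squared distance, and still at least m; this is where e / 4 comes from. *)
  have := m_le _ (S_comb (1 / 2) (Sx_ i) Sd').
  have := Jx_ i; have := Jx_ j; have := NP _ Ni; have := NP _ Nj.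
  rewrite /J !form_comb_sqr// !l_comb//.
  rewrite (BC (Sx_ i) Sd') B_comb// (BC (Sx_ j) (Sx_ i)). move: (j.+1%:R^-1) (i.+1%:R^-1) => c1 c2 *; clearbody m; lra.
exists u; split=> // v Sv; apply/eqP; rewrite -subr_eq0; apply/eqP.
apply: (@sqr_arbitrarily_small _ _ (4 * B v v)); first by rewrite mulr_ge0// B_ge0.
move=> e e0; have [N1 N1P] := inv_small e e0; have [N2 N2P] := uP e e0.
pose n := maxn N1 N2.
have h1 := N1P n (leq_maxl _ _); have h2 := N2P n (leq_maxr _ _).
have Sd := S_comb (-1) (Sx_ n) Su.
have h3 := form_cauchy_schwarz Sd Sv; rewrite B_comb// in h3.
(* Approximate Euler-Lagrange equation: [x_ n] minimizes [J] up to 1/(n+1), also along the line in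
   direction v, so a quadratic polynomial in t is nonnegative. *)
have h4 : (B (x_ n) v - l v) ^+ 2 <= n.+1%:R^-1 * B v v.
  apply: discriminant_le; first exact: B_ge0.
  move=> t; have := m_le _ (S_comb t (Sx_ n) Sv); rewrite l_shift//.
  have := Jx_ n; move: (n.+1%:R^-1) => c *; lra.
have Bv := B_ge0 Sv.
have h5 := ler_wpM2r Bv h1; have h6 := ler_wpM2r Bv h2.
(* The wanted difference is p - q with p = B x_n v - l v and q = B (x_n - u) v; this gives (p - q)^2
   <= 2 p^2 + 2 q^2, hence the constant 4. *)
have := sqr_ge0 ((B (x_ n) v - l v) + (B (x_ n) v + -1 * B u v)).
move: h3 h4 h5 h6; set i := n.+1%:R^-1; set b := B (comb _ _ _) (comb _ _ _).
set w := B (x_ n) v; set z := B u v; set y := l v; set c := B v v.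
rewrite !expr2 => h3 h4 h5 h6; lra.
Qed.

End Riesz.

(** * Real square-integrable functions *)

Section SquareIntegrableReal.
Context d (T : measurableType d) (R : realType).
Variables (mu : {measure set T -> \bar R}) (D : set T).
Hypothesis mD : measurable D.
Implicit Types f g h : T -> R.

Definition sqint f : Prop :=
  measurable_fun D f /\ (\int[mu]_(x in D) ((f x) ^+ 2)%:E < +oo)%E.

Definition ip f g : R := \int[mu]_(x in D) (f x * g x).

Lemma sqint_sqr_integrable f : sqint f ->
  mu.-integrable D (fun x => ((f x) ^+ 2)%:E).
Proof.
move=> [mf fi]; apply/integrableP; split.
  exact/measurable_EFinP/measurable_funX.
rewrite (eq_integral (fun x => ((f x) ^+ 2)%:E))// => x _.
by rewrite gee0_abs// lee_fin sqr_ge0.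
Qed.

Lemma sqint_mul_integrable f g : sqint f -> sqint g ->
  mu.-integrable D (fun x => (f x * g x)%:E).
Proof.
move=> sf sg; have [mf _] := sf; have [mg _] := sg.
have h := integrableD mD (sqint_sqr_integrable sf) (sqint_sqr_integrable sg).
apply: (le_integrable mD _ _ h).
  exact/measurable_EFinP/measurable_funM.
move=> x Dx /=; rewrite lee_fin [leRHS]ger0_norm ?addr_ge0 ?sqr_ge0//.
rewrite ler_norml !expr2.
have := sqr_ge0 (f x + g x); have := sqr_ge0 (f x - g x).
by rewrite !expr2 => *; apply/andP; split; nra.
Qed.

Lemma ipE f g : sqint f -> sqint g ->
  (ip f g)%:E = (\int[mu]_(x in D) (f x * g x)%:E)%E.
Proof.
move=> sf sg; rewrite /ip /Rintegral fineK//.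
exact/integrable_fin_num/sqint_mul_integrable.
Qed.

Lemma ip_sqrE f : sqint f -> (ip f f)%:E = (\int[mu]_(x in D) ((f x) ^+ 2)%:E)%E.
Proof. by move=> sf; rewrite ipE//; apply: eq_integral => x _; rewrite expr2. Qed.

Lemma ipC f g : ip f g = ip g f.
Proof. by apply: eq_Rintegral => x _; rewrite mulrC. Qed.

Lemma ip_ge0 f : 0 <= ip f f.
Proof. by apply: Rintegral_ge0 => x _; rewrite -expr2 sqr_ge0. Qed.

Lemma sqintDM t f g : sqint f -> sqint g -> sqint (fun x => f x + t * g x).
Proof.
move=> sf sg; have [mf _] := sf; have [mg _] := sg; split.
  by apply: measurable_funD => //; apply: measurable_funM => //; exact: measurable_cst.
have h := integrableD mD (integrableZl mD 2 (sqint_sqr_integrable sf))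
  (integrableZl mD (2 * t ^+ 2) (sqint_sqr_integrable sg)).
have mfg : measurable_fun D (fun x => ((f x + t * g x) ^+ 2)%:E).
  apply/measurable_EFinP/measurable_funX/measurable_funD => //.
  by apply: measurable_funM => //; exact: measurable_cst.
have /integrableP[_] : mu.-integrable D (fun x => ((f x + t * g x) ^+ 2)%:E).
  apply: (le_integrable mD mfg _ h) => x Dx /=.
  rewrite lee_fin ger0_norm ?sqr_ge0// [leRHS]ger0_norm.
    by have := sqr_ge0 (f x - t * g x); rewrite !expr2 => *; nra.
  have := sqr_ge0 (f x); have := mulr_ge0 (sqr_ge0 t) (sqr_ge0 (g x)); lra.
rewrite (eq_integral (fun x => ((f x + t * g x) ^+ 2)%:E))// => x _.
by rewrite gee0_abs// lee_fin sqr_ge0.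
Qed.

Lemma sqint0 : sqint (fun _ => 0).
Proof.
split; first exact: measurable_cst.
by under eq_integral do rewrite expr0n/=; rewrite integral0.
Qed.

Lemma sqintZ t f : sqint f -> sqint (fun x => t * f x).
Proof. by move=> sf; have := sqintDM t sqint0 sf; under eq_fun do rewrite add0r. Qed.

Lemma sqintD f g : sqint f -> sqint g -> sqint (fun x => f x + g x).
Proof.
move=> sf sg; have := sqintDM 1 sf sg.
by under eq_fun do rewrite mul1r.
Qed.

Lemma sqintB f g : sqint f -> sqint g -> sqint (fun x => f x - g x).
Proof.
move=> sf sg; have := sqintDM (-1) sf sg.
by under eq_fun do rewrite mulN1r.
Qed.

Lemma ipDMl t f g h : sqint f -> sqint g -> sqint h ->
  ip (fun x => f x + t * g x) h = ip f h + t * ip g h.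
Proof.
move=> sf sg sh; rewrite /ip.
under eq_Rintegral do rewrite mulrDl -mulrA.
rewrite RintegralD ?RintegralZl//; first exact: sqint_mul_integrable.
- exact: sqint_mul_integrable.
- exact: (integrableZl mD t (sqint_mul_integrable sg sh)).
Qed.

Lemma ip_eq f f' g g' : (forall x, D x -> f x = f' x) ->
  (forall x, D x -> g x = g' x) -> ip f g = ip f' g'.
Proof.
by move=> ff' gg'; apply: eq_Rintegral => x /set_mem Dx; rewrite ff'// gg'.
Qed.

Lemma sqint_eq f f' : (forall x, D x -> f x = f' x) -> sqint f -> sqint f'.
Proof.
move=> ff' [mf fi]; split.
  by apply: eq_measurable_fun mf => x /set_mem; exact: ff'.
rewrite (eq_integral (fun x => ((f x) ^+ 2)%:E))// => x /set_mem Dx.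
by rewrite ff'.
Qed.

Lemma ipBl f g h : sqint f -> sqint g -> sqint h ->
  ip (fun x => f x - g x) h = ip f h - ip g h.
Proof.
move=> sf sg sh; rewrite -[in RHS]mulN1r -ipDMl//.
by apply: ip_eq => // x _; rewrite mulN1r.
Qed.

Lemma ipDl f g h : sqint f -> sqint g -> sqint h ->
  ip (fun x => f x + g x) h = ip f h + ip g h.
Proof.
move=> sf sg sh; rewrite -[X in _ + X]mul1r -ipDMl//.
by apply: ip_eq => // x _; rewrite mul1r.
Qed.

Lemma ipZl t f g : sqint f -> sqint g -> ip (fun x => t * f x) g = t * ip f g.
Proof.
move=> sf sg; rewrite /ip; under eq_Rintegral do rewrite -mulrA.
by rewrite RintegralZl//; exact: sqint_mul_integrable.
Qed.

Lemma ip_cauchy_schwarz f g : sqint f -> sqint g ->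
  ip f g ^+ 2 <= ip f f * ip g g.
Proof.
move=> sf sg; apply: (@form_cauchy_schwarz _ _ (fun t f g x => f x + t * g x) sqint ip).
- by move=> *; exact: sqintDM.
- by move=> *; apply: ipC.
- by move=> *; apply: ipDMl.
- by move=> *; apply: ip_ge0.
- by [].
- by [].
Qed.

Lemma ip_eq0_ae f : sqint f -> ip f f = 0 -> {ae mu, forall x, D x -> f x = 0}.
Proof.
move=> sf f0; have [mf _] := sf.
have m2 : measurable_fun D (fun x => ((f x) ^+ 2)%:E).
  exact/measurable_EFinP/measurable_funX.
have := (ae_eq_integral_abs mu mD m2).1.
have -> : (\int[mu]_(x in D) `|((f x) ^+ 2)%:E| = 0)%E.
  rewrite -[RHS]/(0%:E) -f0 ip_sqrE//; apply: eq_integral => x _.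
  by rewrite gee0_abs// lee_fin sqr_ge0.
move=> /(_ erefl); apply: filterS => x /= h Dx.
by have /eqP := h Dx; rewrite eqe sqrf_eq0 => /eqP.
Qed.

End SquareIntegrableReal.

(** * Completeness of the real space L^2(D) *)

Section Completeness.
Context d (T : measurableType d) (R : realType).
Variables (mu : {measure set T -> \bar R}) (D : set T).
Hypothesis mD : measurable D.
Local Notation sqint := (sqint mu D).
Local Notation ip := (ip mu D).

Lemma sqint_fatou (h_ : nat -> T -> R) (h : T -> R) (e : R) :
  (forall n, sqint (h_ n)) -> measurable_fun D h ->
  {ae mu, forall x, D x -> h_ ^~ x @ \oo --> h x} ->
  (\forall n \near \oo, ip (h_ n) (h_ n) <= e) ->
  sqint h /\ ip h h <= e.
Proof.
move=> sh mh [N [mN N0 hN]] he.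
(* Convergence is known only off the null set [N]; removing it leaves the integral unchanged and
   makes the convergence hold everywhere. *)
have mDN : measurable (D `\` N) by exact: measurableD.
have m2 n : measurable_fun D (fun x => ((h_ n x) ^+ 2)%:E).
  by have [mn _] := sh n; exact/measurable_EFinP/measurable_funX.
have mh2 : measurable_fun D (fun x => ((h x) ^+ 2)%:E).
  exact/measurable_EFinP/measurable_funX.
have key : (\int[mu]_(x in D) ((h x) ^+ 2)%:E <= e%:E)%E.
  rewrite (ge0_negligible_integral mN mD)//; last first.
    by move=> x _; rewrite lee_fin sqr_ge0.
  rewrite (eq_integral (fun x => limn_einf (fun n => ((h_ n x) ^+ 2)%:E))); last first.
    move=> x /set_mem[Dx Nx]; apply/esym.
    have hx : h_ ^~ x @ \oo --> h x.
      by apply: contrapT => nh; apply: Nx; apply: hN => /= /(_ Dx).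
    apply: (cvg_limn_einf_sup _).1; apply: cvg_EFin; first by near=> n.
    rewrite expr2; under eq_fun do rewrite expr2; exact: cvgM.
  apply: le_trans.
    apply: (fatou mu mDN) => n; last by move=> x _; rewrite lee_fin sqr_ge0.
    by apply: measurable_funS (m2 n) => //; exact: subDsetl.
  rewrite limn_einf_lim; apply: lime_le; first exact: is_cvg_einfs.
  near=> n; apply: ge_ereal_inf; exists (\int[mu]_(x in D `\` N) ((h_ n x) ^+ 2)%:E)%E.
    by exists n => /=.
  apply: (@le_trans _ _ (\int[mu]_(x in D) ((h_ n x) ^+ 2)%:E)%E).
    apply: (ge0_subset_integral mu mDN mD (m2 n)); [|by move=> x []].
    by move=> x _; rewrite lee_fin sqr_ge0.
  rewrite -ip_sqrE// lee_fin; near: n; exact: he.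
have sqh : sqint h by split=> //; apply: le_lt_trans key _; rewrite ltry.
by split=> //; rewrite -lee_fin ip_sqrE.
Unshelve. all: by end_near.
Qed.

(* Along a subsequence whose increments d_k satisfy |d_k|^2 <= 8^-k in L^2, the
   series of 4^k d_k^2 is integrable, so that d_k = O(2^-k) almost everywhere;
   Fatou's lemma turns the pointwise limit into an L^2 limit. *)
Lemma sqint_complete (f_ : nat -> T -> R) :
  (forall n, sqint (f_ n)) ->
  (forall e : R, 0 < e -> exists N, forall m n, (N <= m)%N -> (N <= n)%N ->
    ip (fun x => f_ m x - f_ n x) (fun x => f_ m x - f_ n x) <= e) ->
  exists f, sqint f /\ forall e : R, 0 < e -> exists N, forall n, (N <= n)%N ->
    ip (fun x => f_ n x - f x) (fun x => f_ n x - f x) <= e.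
Proof.
move=> sf cf; have /choice[N_ NP] : forall k : nat, exists N, forall m n,
    (N <= m)%N -> (N <= n)%N ->
    ip (fun x => f_ m x - f_ n x) (fun x => f_ m x - f_ n x) <= 8 ^- k.
  by move=> k; apply: cf; rewrite invr_gt0 exprn_gt0.
(* Summing the ranks makes [p] monotone and at least [N_ k]; the summand k sends it to infinity. *)
pose p k := (\sum_(i < k.+1) N_ i + k)%N.
have Np k : (N_ k <= p k)%N by rewrite /p big_ord_recr /= -addnA addnCA leq_addr.
have pS k : (p k <= p k.+1)%N.
  by rewrite /p leq_add// [leqRHS]big_ord_recr leq_addr.
have leq_p k : (k <= p k)%N by rewrite leq_addl.
pose g k := f_ (p k); pose dg k x := g k.+1 x - g k x.
have sg k : sqint (g k) by exact: sf.
have sdg k : sqint (dg k) by exact: sqintB.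
have mdg k : measurable_fun D (fun x => (4 ^+ k * dg k x ^+ 2)%:E).
  have [m _] := sdg k; apply/measurable_EFinP/measurable_funM; first exact: measurable_cst.
  exact: measurable_funX.
have dg0 k x : D x -> (0 <= (4 ^+ k * dg k x ^+ 2)%:E)%E.
  by move=> _; rewrite lee_fin mulr_ge0 ?sqr_ge0// exprn_ge0.
pose H x := (\sum_(k <oo) (4 ^+ k * dg k x ^+ 2)%:E)%E.
have intH : (\int[mu]_(x in D) H x <= 2%:E)%E.
  rewrite integral_nneseries//.
  have int_le k : (\int[mu]_(x in D) (4 ^+ k * dg k x ^+ 2)%:E <= (2 ^- k)%:E)%E.
    under eq_integral do rewrite EFinM.
    have m2 : measurable_fun D (fun x => (dg k x ^+ 2)%:E).
      by apply/measurable_EFinP/measurable_funX; case: (sdg k).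
    rewrite (ge0_integralZl mu mD m2);
      [|by move=> x _; rewrite lee_fin sqr_ge0|by rewrite lee_fin exprn_ge0].
    rewrite -ip_sqrE// -EFinM lee_fin.
    apply: (@le_trans _ _ (4 ^+ k * 8 ^- k)).
      rewrite ler_pM2l ?exprn_gt0//; apply: NP => //.
      exact: leq_trans (pS k).
    by rewrite -!exprVn -exprMn (_ : 4 * 8^-1 = 2^-1)//; field.
  apply: lime_le; first by apply: is_cvg_nneseries => n _ _; apply: integral_ge0 => x; exact: dg0.
  apply: nearW => n; apply: (@le_trans _ _ (\sum_(0 <= k < n) (2 ^- k)%:E)%E).
    exact: lee_sum.
  rewrite sumEFin lee_fin.
  have -> : \sum_(0 <= k < n) 2 ^- k = 2 - 2 * 2 ^- n :> R.
    elim: n => [|n IHn]; first by rewrite big_geq// expr0 invr1 mulr1 subrr.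
    by rewrite big_nat_recr//= IHn exprS invfM; field; rewrite expf_neq0.
  by rewrite gerBl mulr_ge0// invr_ge0 exprn_ge0.
have mH : measurable_fun D H.
  apply: (emeasurable_fun_cvg (fun n x => \sum_(0 <= k < n) (4 ^+ k * dg k x ^+ 2)%:E)%E).
    by move=> n; exact: emeasurable_sum.
  by move=> x Dx; apply: is_cvg_nneseries => n _ _; exact: dg0.
have iH : mu.-integrable D H.
  apply/integrableP; split=> //.
  rewrite (eq_integral H) ?(le_lt_trans intH) ?ltry// => x /set_mem Dx.
  by rewrite gee0_abs//; apply: nneseries_ge0 => n _ _; exact: dg0.
pose A := D `&` [set x | H x \is a fin_num].
have mA : measurable A by exact: emeasurable_fin_num.
(* Cutting off to the set where the series is finite gives a limit at every point of D, so that the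
   limit function is measurable; almost everywhere nothing has changed. *)
pose gA k x := g k x * \1_A x.
have gA_cvg x : D x -> cvgn (gA ^~ x).
  move=> Dx; rewrite /gA indicE; have [/set_mem[_ Hx]|_] := boolP (x \in A); last first.
    by under eq_fun do rewrite mulr0; exact: is_cvg_cst.
  under eq_fun do rewrite mulr1.
  have : cvgn (series (dg ^~ x)).
    (* With s = 2^n |d_n|, one has s <= (1 + s^2) / 2 and s^2 = 4^n d_n^2 <= H x; the increments are
       dominated by c 2^-n. *)
    apply: normed_cvg; pose c := (1 + fine (H x)) / 2.
    have c0 : 0 <= fine (H x) by apply/fine_ge0/nneseries_ge0 => n _ _; exact: dg0.
    apply: (@series_le_cvg _ _ (geometric c 2^-1)) => [n|n|n|].
    - exact: normr_ge0.
    - by rewrite /= mulr_ge0 ?exprn_ge0 ?invr_ge0// divr_ge0// addr_ge0.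
    - rewrite /= /c exprVn.
      have hn : 4 ^+ n * dg n x ^+ 2 <= fine (H x).
        rewrite -lee_fin fineK//.
        apply: le_trans (nneseries_lim_ge n.+1 _); last by move=> k _ _; exact: dg0.
        rewrite big_nat_recr//= leeDr// sume_ge0// => k _; exact: dg0.
      rewrite -(@ler_pM2l _ (2 ^+ n)) ?exprn_gt0//.
      rewrite mulrCA divff ?expf_neq0// mulr1.
      rewrite (_ : 4 = 2 ^+ 2 :> R) in hn; last by ring.
      rewrite -exprM mulnC exprM -exprMn in hn.
      rewrite -{1}(@ger0_norm _ (2 ^+ n)) ?exprn_ge0// -normrM.
      have := sqr_ge0 (`|2 ^+ n * dg n x| - 1).
      rewrite -real_normK ?num_real// in hn; rewrite !expr2 in hn *; lra.
    - by apply: is_cvg_geometric_series; rewrite ger0_norm ?invr_ge0// invf_lt1// ltr1n.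
  move=> cs; rewrite (_ : (fun n => g n x) = (fun n => g 0%N x + series (dg ^~ x) n)).
    by apply: is_cvgD => //; exact: is_cvg_cst.
  by apply/funext => n; rewrite (eq_sum_telescope (g ^~ x)).
have gA_lim x : D x -> gA ^~ x @ \oo --> limn (gA ^~ x) by move=> /gA_cvg.
pose f x := limn (gA ^~ x).
have mf : measurable_fun D f.
  apply: (@measurable_fun_cvg _ _ _ _ gA) => // k.
  by apply: measurable_funM; [case: (sg k)|exact: measurable_indic].
have gf : {ae mu, forall x, D x -> g ^~ x @ \oo --> f x}.
  apply: filterS (integrable_ae mD iH) => x hx Dx.
  have := gA_lim x Dx; rewrite -/(f x); apply: cvg_trans; apply: near_eq_cvg.
  by apply: nearW => k; rewrite /gA indicE mem_set ?mulr1//; split=> //; exact: hx.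
(* Here n is fixed while the subsequence runs to its limit. The case e = 1 also puts f in L^2, as
   [f_ N] minus a square-integrable difference. *)
have fatou_n (e : R) n : 0 < e -> (forall k, (n <= k)%N ->
    ip (fun x => f_ n x - f_ k x) (fun x => f_ n x - f_ k x) <= e) ->
    sqint (fun x => f_ n x - f x) /\
    ip (fun x => f_ n x - f x) (fun x => f_ n x - f x) <= e.
  move=> e0 hn; apply: (@sqint_fatou (fun k x => f_ n x - g k x)).
  - by move=> k; exact: sqintB.
  - by apply: measurable_funB => //; case: (sf n).
  - apply: filterS gf => x hx Dx; apply: cvgB; [exact: cvg_cst|exact: hx].
  - exists n => // k /= nk; apply: hn; exact: (leq_trans nk (leq_p k)).
have sqf : sqint f.
  have [N hN] := cf 1 ltr01.
  have [||s _] := fatou_n 1 N => //; first by move=> k; exact: hN.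
  by apply: sqint_eq (sqintB mD (sf N) s) => // x _; rewrite opprB addrC subrK.
exists f; split=> // e e0; have [N hN] := cf e e0; exists N => n Nn.
have [//|//|] := fatou_n e n => // k nk; apply: hN => //; exact: leq_trans nk.
Qed.

End Completeness.

(** * Smooth functions and test functions on the plane *)

Section PlaneMeasurability.
Context {R : realType}.
Local Notation plane := (measurableTypeR R * measurableTypeR R)%type.

(** The sigma-algebra of the plane is a product, not generated from its topology; the link is that
    an open set is the countable union of the boxes with rational corners that it contains. *)
Lemma open_measurable2 (U : set (R * R)) : open U -> measurable (U : set plane).
Proof.
move=> oU.
pose box (q : (rat * rat) * (rat * rat)) : set plane :=
  `]ratr q.1.1, ratr q.1.2[%classic `*` `]ratr q.2.1, ratr q.2.2[%classic.
pose G (q : (rat * rat) * (rat * rat)) : set plane :=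
  if pselect (box q `<=` U) then box q else set0.
have -> : U = \bigcup_q G q.
  apply/seteqP; split=> [[x y] Uxy|p [q _]]; last first.
    by rewrite /G; case: pselect => // sub /sub.
  have : nbhs (x, y) U by exact: open_nbhs_nbhs.
  move=> [[/= A B] [/nbhs_ballP[e e0 eA] /nbhs_ballP[e' e0' eB]]] ABU.
  have rat2 (z r : R) : 0 < r -> exists q1 q2 : rat,
      (z \in `]ratr q1, ratr q2[) /\ `]ratr q1, ratr q2[%classic `<=` ball z r.
    move=> r0; have [q1] : exists q : rat, (ratr q : R) \in (`]z - r, z[)
      by apply: rat_in_itvoo; rewrite gtrBl.
    have [q2] : exists q : rat, (ratr q : R) \in (`]z, (z + r)[)
      by apply: rat_in_itvoo; rewrite ltrDl.
    rewrite !in_itv /= => /andP[zq2 q2r] /andP[rq1 q1z]; exists q1, q2; split.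
      by rewrite in_itv /= q1z.
    move=> w; rewrite /= in_itv /= => /andP[q1w wq2].
    rewrite /ball /= ltr_distlC; lra.
  have [q1 [q2 [zx subx]]] := rat2 x e e0; have [q3 [q4 [zy suby]]] := rat2 y e' e0'.
  have sub : box ((q1, q2), (q3, q4)) `<=` U.
    by move=> [u v] [/= hu hv]; apply: ABU; split; [apply: eA; exact: subx|apply: eB; exact: suby].
  exists ((q1, q2), (q3, q4)) => //; rewrite /G; case: pselect => // _.
apply: countable_bigcupT_measurable => [|q]; first exact: countableP.
by rewrite /G; case: pselect => s; [exact: measurableX|exact: measurable0].
Qed.

Lemma continuous_measurable_fun2 (f : R * R -> R) :
  continuous f -> measurable_fun setT (f : plane -> measurableTypeR R).
Proof.
move=> cf; apply: (measurability _ (RGenOInfty.measurableE R)) => //.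
move=> /= _ [_ [a ->] <-]; rewrite setTI; apply: open_measurable2.
by move/continuousP : cf; apply; exact: interval_open.
Qed.

End PlaneMeasurability.

Section SmoothCalculus.
Context {R : realType}.
Implicit Types (f g : R * R -> R) (D : set (R * R)) (j : bool).

Lemma smooth_differentiable f p : smooth f -> differentiable f p.
Proof. by move=> sf; exact: (sf [::]). Qed.

Lemma smooth_pderiv j f : smooth f -> smooth (pderiv j f).
Proof. by move=> sf s p; have := sf (rcons s j) p; rewrite foldr_rcons. Qed.

Lemma smooth_continuous f : smooth f -> continuous f.
Proof.
by move=> sf p; apply: differentiable_continuous; exact: smooth_differentiable.
Qed.

(** Coinduction principle replacing inductions on the list of derivatives: it suffices to find a
    class of differentiable functions stable under both partial derivatives. Each smoothness proof
    below amounts to a choice of class. *)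
Lemma smooth_coind (C : (R * R -> R) -> Prop) :
  (forall f, C f -> (forall p, differentiable f p) /\ forall j, C (pderiv j f)) ->
  forall f, C f -> smooth f.
Proof.
move=> hC f Cf s p; suff : C (foldr (@pderiv R) f s) by move=> /hC[].
by elim: s => //= j s /hC[].
Qed.

(** Products alone are not stable under differentiation: the Leibniz rule produces sums of products,
    so the class is closed under both. *)
Inductive smooth_polynomial : (R * R -> R) -> Prop :=
| SmoothAtom f : smooth f -> smooth_polynomial f
| SmoothAdd f g : smooth_polynomial f -> smooth_polynomial g ->
    smooth_polynomial (f + g)
| SmoothMul f g : smooth_polynomial f -> smooth_polynomial g ->
    smooth_polynomial (f * g).

Lemma pderivD j f g : (forall p, differentiable f p) ->
  (forall p, differentiable g p) ->
  pderiv j (f + g) = pderiv j f + pderiv j g.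
Proof.
move=> df dg; apply/funext => p.
by rewrite /pderiv deriveD//; apply: diff_derivable.
Qed.

Lemma pderivM j f g : (forall p, differentiable f p) ->
  (forall p, differentiable g p) ->
  pderiv j (f * g) = f * pderiv j g + g * pderiv j f.
Proof.
move=> df dg; apply/funext => p.
by rewrite /pderiv deriveM//; apply: diff_derivable.
Qed.

Lemma smooth_polynomial_smooth f : smooth_polynomial f -> smooth f.
Proof.
apply: smooth_coind => {}f.
elim=> {f} [f sf|f g Pf [df hf] Pg [dg hg]|f g Pf [df hf] Pg [dg hg]]; split.
- by move=> p; exact: smooth_differentiable.
- by move=> j; apply: SmoothAtom; exact: smooth_pderiv.
- by move=> p; exact: differentiableD.
- by move=> j; rewrite pderivD//; exact: SmoothAdd.
- by move=> p; exact: differentiableM.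
- by move=> j; rewrite pderivM//; apply: SmoothAdd; apply: SmoothMul.
Qed.

Lemma smoothD f g : smooth f -> smooth g -> smooth (f + g).
Proof.
move=> sf sg; apply: smooth_polynomial_smooth.
by apply: SmoothAdd; exact: SmoothAtom.
Qed.

Lemma smoothM f g : smooth f -> smooth g -> smooth (f * g).
Proof.
move=> sf sg; apply: smooth_polynomial_smooth.
by apply: SmoothMul; exact: SmoothAtom.
Qed.

Lemma pderiv_cst j (c : R) : pderiv j (cst c) = cst 0.
Proof. by apply/funext => p; rewrite /pderiv derive_cst. Qed.

Lemma smooth_cst (c : R) : smooth (cst c).
Proof.
apply: (@smooth_coind (fun f => exists c, f = cst c)); last by exists c.
move=> f [{}c ->]; split=> [p|j]; first exact: differentiable_cst.
by exists 0; rewrite pderiv_cst.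
Qed.

Lemma smoothZ (c : R) f : smooth f -> smooth (cst c * f).
Proof. by apply: smoothM; exact: smooth_cst. Qed.

Lemma pderivZ j (c : R) f : smooth f -> pderiv j (cst c * f) = cst c * pderiv j f.
Proof.
move=> sf; rewrite pderivM => [|p|p].
- by rewrite pderiv_cst; apply/funext => p /=; rewrite mulr0 addr0.
- exact: differentiable_cst.
- exact: smooth_differentiable.
Qed.

Lemma plane_hausdorff : hausdorff_space (R * R)%type.
Proof. exact: norm_hausdorff. Qed.

Lemma pderiv_eq0 (K : set (R * R)) f j p : compact K ->
  (forall p, ~ K p -> f p = 0) -> ~ K p -> pderiv j f p = 0.
Proof.
move=> cK fK nKp; rewrite /pderiv (@near_eq_derive _ _ _ f (cst 0)).
  by rewrite derive_cst.
have oKc : open (~` K) by rewrite openC; exact: compact_closed plane_hausdorff cK.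
by apply: filterS (open_nbhs_nbhs (conj oKc nKp)) => q; exact: fK.
Qed.

Lemma test_pderiv D j f : test_function D f -> test_function D (pderiv j f).
Proof.
move=> [sf [K [cK KD fK]]]; split; first exact: smooth_pderiv.
by exists K; split=> // p; exact: pderiv_eq0.
Qed.

Lemma test_mul D f g : test_function D f -> smooth g -> test_function D (f * g).
Proof.
move=> [sf [K [cK KD fK]]] sg; split; first exact: smoothM.
exists K; split=> // p /fK fp.
by rewrite -[LHS]/(f p * g p) fp mul0r.
Qed.

Lemma test_add D f g : test_function D f -> test_function D g ->
  test_function D (f + g).
Proof.
move=> [sf [K [cK KD fK]]] [sg [L [cL LD gL]]]; split; first exact: smoothD.
exists (K `|` L); split.
- exact: compactU.
- by move=> p [/KD|/LD].
- by move=> p /not_orP[/fK fp /gL gp]; rewrite -[LHS]/(f p + g p) fp gp addr0.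
Qed.

Lemma test_scale D (c : R) f : test_function D f -> test_function D (cst c * f).
Proof. by move=> tf; rewrite mulrC; apply: test_mul => //; exact: smooth_cst. Qed.

Lemma test0 D : test_function D (cst 0).
Proof.
split; first exact: smooth_cst.
by exists set0; split=> //; exact: compact0.
Qed.

Lemma test_bounded D f : test_function D f -> exists2 M, 0 <= M & forall p, `|f p| <= M.
Proof.
move=> [sf [K [cK _ fK]]].
have [K0|K0] := pselect (K !=set0); last first.
  exists 0 => // p; rewrite fK ?normr0// => Kp; apply: K0; by exists p.
have [|c cK' hc] := @compact_EVT_max _ _ (fun p => `|f p|) K K0 cK.
  apply: continuous_subspaceT => p; apply: continuous_comp; last exact: norm_continuous.
  exact: smooth_continuous.
exists `|f c| => // p; have [Kp|nKp] := pselect (K p).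
  by apply: hc; rewrite inE.
by rewrite fK// normr0.
Qed.

Lemma test_box D f : test_function D f ->
  exists2 N, 0 < N & forall p, f p != 0 -> `|p.1| <= N /\ `|p.2| <= N.
Proof.
move=> [_ [K [/compact_bounded[N [_ hN]] _ fK]]].
exists (Num.max N 0 + 1); first by rewrite ltr_wpDl// le_max lexx orbT.
move=> p fp; have Kp : K p by apply: contrapT => /fK /eqP; rewrite (negbTE fp).
have := hN (Num.max N 0 + 1); rewrite ltr_pwDr// ?le_max ?lexx// => /(_ isT p Kp).
by rewrite /= prod_normE ge_max => /andP.
Qed.

(** The maximum of [|p.2|] over the compact support is attained inside the strip, hence below a; b
    is the midpoint between this maximum and a. The remaining room keeps the tangent finite in the
    Poincare inequality and hosts the boundary layer of the trial function. *)
Lemma test_strip_box (a : R) f : 0 < a -> test_function (strip a) f ->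
  exists2 b, 0 < b < a & forall p, f p != 0 -> `|p.2| <= b.
Proof.
move=> a0 [sf [K [cK KD fK]]].
have fKp p : f p != 0 -> K p by move=> fp; apply: contrapT => /fK /eqP; rewrite (negbTE fp).
have [K0|K0] := pselect (K !=set0); last first.
  exists (a / 2); first by rewrite divr_gt0// ltr_pdivrMr// ltr_pMr// ltr1n.
  by move=> p /fKp Kp; exfalso; apply: K0; exists p.
have [|c /set_mem Kc hc] := @compact_EVT_max _ _ (fun p => `|p.2|) K K0 cK.
  apply: continuous_subspaceT => p; apply: continuous_comp; last exact: norm_continuous.
  exact: cvg_snd.
have := KD _ Kc; rewrite /strip /= -ltr_norml => ca.
exists ((`|c.2| + a) / 2); first by have := normr_ge0 c.2; move=> *; apply/andP; split; lra.
move=> p /fKp Kp; have := hc p; rewrite inE => /(_ Kp) => *; lra.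
Qed.

Lemma test_slice f x y : differentiable f (x, y) ->
  is_derive y 1 (fun t => f (x, t)) (pderiv true f (x, y)).
Proof.
move=> /(@diff_derivable _ _ _ f _ (axis true)) df.
have E : (fun h : R => h^-1 *: (((fun t => f (x, t)) \o shift y) (h *: 1) - f (x, y)))
       = (fun h : R => h^-1 *: ((f \o shift (x, y)) (h *: axis true) - f (x, y))).
  apply/funext => h /=; congr (_ *: (f _ - _)).
  by rewrite /shift /= /axis; congr pair; rewrite /= [h *: 0]mulr0 add0r.
by apply: DeriveDef; [rewrite /derivable E|rewrite /pderiv /derive E].
Qed.

Lemma test_slice1 f x y : differentiable f (x, y) ->
  is_derive x 1 (fun t => f (t, y)) (pderiv false f (x, y)).
Proof.
move=> /(@diff_derivable _ _ _ f _ (axis false)) df.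
have E : (fun h : R => h^-1 *: (((fun t => f (t, y)) \o shift x) (h *: 1) - f (x, y)))
       = (fun h : R => h^-1 *: ((f \o shift (x, y)) (h *: axis false) - f (x, y))).
  apply/funext => h /=; congr (_ *: (f _ - _)).
  by rewrite /shift /= /axis; congr pair; rewrite /= [h *: 0]mulr0 add0r.
by apply: DeriveDef; [rewrite /derivable E|rewrite /pderiv /derive E].
Qed.

End SmoothCalculus.

(** * Integration of test functions *)

Section IntegralLemmas.
Context {R : realType}.
Local Notation leb := (@lebesgue_measure R).

Lemma scaled_indic_integral d (T : measurableType d) (mu : {measure set T -> \bar R})
    (A : set T) (M : R) : measurable A -> (mu A < +oo)%E ->
  mu.-integrable setT (fun x => (M * \1_A x : R)%:E) /\
  \int[mu]_x (M * \1_A x) = M * fine (mu A).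
Proof.
move=> mA Afin.
have intA : mu.-integrable setT (fun x => (\1_A x : R)%:E).
  apply/integrableP; split; first exact/measurable_EFinP/measurable_indic.
  rewrite (eq_integral (fun x => (\1_A x : R)%:E)); last first.
    by move=> x _; rewrite gee0_abs// lee_fin.
  by rewrite integral_indic// setIT.
split; first exact: (integrableZl measurableT M intA).
rewrite RintegralZl// /Rintegral.
by rewrite (_ : (\int[mu]_x (\1_A x)%:E)%E = mu A)// integral_indic// setIT.
Qed.

Lemma bounded_integrable d (T : measurableType d) (mu : {measure set T -> \bar R})
    (A : set T) (f : T -> R) (M : R) :
  measurable A -> (mu A < +oo)%E -> measurable_fun setT f ->
  (forall x, `|f x| <= M * \1_A x) ->
  mu.-integrable setT (fun x => (f x)%:E) /\
  \int[mu]_x f x <= M * fine (mu A).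
Proof.
move=> mA Afin mf fM; have [intM <-] := scaled_indic_integral M mA Afin.
have intf : mu.-integrable setT (fun x => (f x)%:E).
  apply: (le_integrable measurableT _ _ intM) => /=; first exact/measurable_EFinP.
  by move=> x _; rewrite lee_fin (le_trans (fM x))// ler_norm.
split=> //.
by apply: le_Rintegral => // x _; exact: le_trans (ler_norm _) (fM x).
Qed.

Lemma FTC_segment (g h : R -> R) (l r : R) : l < r ->
  (forall t, l <= t <= r -> is_derive t 1 g (h t)) ->
  {within `[l, r], continuous h} ->
  (\int[leb]_(t in `[l, r]) (h t)%:E = (g r)%:E - (g l)%:E)%E.
Proof.
move=> lr dg ch; apply: continuous_FTC2 => //.
  have cg t : l <= t <= r -> {for t, continuous g}.
    move=> tlr; apply: differentiable_continuous; apply/derivable1_diffP.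
    by have [] := dg t tlr.
  split.
  - by move=> t; rewrite in_itv /= => /andP[/ltW lt /ltW tr]; have [] := dg t (introT andP (conj lt tr)).
  - by apply: cvg_at_right_filter; apply: cg; rewrite lexx ltW.
  - by apply: cvg_at_left_filter; apply: cg; rewrite lexx ltW.
move=> t; rewrite in_itv /= => /andP[/ltW lt /ltW tr].
by rewrite derive1E; have [_ ->] := dg t (introT andP (conj lt tr)).
Qed.

Lemma integral_segment_support (h : R -> R) (L : R) :
  (forall t, h t != 0 -> `|t| <= L) ->
  (\int[leb]_t (h t)%:E = \int[leb]_(t in `[(- L)%R, L]) (h t)%:E)%E.
Proof.
move=> hL; rewrite [RHS]integral_mkcond; apply: eq_integral => t _.
rewrite patchE; case: ifPn => //; rewrite notin_setE /= => nt.
have [->//|/hL] := eqVneq (h t) 0.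
by rewrite ler_norml => tL; exfalso; apply: nt; rewrite in_itv.
Qed.

Lemma integral_derive_eq0 (g h : R -> R) (L : R) :
  (forall t : R, is_derive t 1 g (h t)) -> continuous h ->
  (forall t, g t != 0 -> `|t| <= L) -> (forall t, h t != 0 -> `|t| <= L) ->
  (\int[leb]_t (h t)%:E = 0)%E.
Proof.
(* A strictly larger segment: g vanishes at its endpoints, and its length is positive whatever the
   sign of L. *)
move=> dg ch gL hL; pose L' := `|L| + 1.
have LL' : L < L' by rewrite (le_lt_trans (ler_norm L))// ltrDl.
have L'0 : 0 < L' by rewrite ltr_wpDl.
rewrite (@integral_segment_support h L'); last first.
  by move=> t /hL tL; apply: le_trans tL (ltW LL').
rewrite (@FTC_segment g) ?gtrN//; last exact: continuous_subspaceT.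
have g0 t : L < `|t| -> g t = 0.
  by move=> Lt; apply/eqP; apply: contraT => /gL; rewrite leNgt Lt.
by rewrite !g0 ?subee// ?normrN gtr0_norm.
Qed.

End IntegralLemmas.

Section PlaneIntegral.
Context {R : realType}.
Local Notation leb := (@lebesgue_measure R).
Local Notation plane := (measurableTypeR R * measurableTypeR R)%type.
Local Notation leb2 := (@lebesgue2 R).
Implicit Types (f g : R * R -> R) (D : set (R * R)) (j : bool).

Lemma continuous_pairr (x : R) : continuous (fun y : R => (x, y)).
Proof. by move=> y; exact: (cvg_pair (cvg_cst x) cvg_id). Qed.

Lemma continuous_pairl (y : R) : continuous (fun x : R => (x, y)).
Proof. by move=> x; exact: (cvg_pair cvg_id (cvg_cst y)). Qed.

Lemma lebesgue2_box (x1 x2 y1 y2 : R) : x1 <= x2 -> y1 <= y2 ->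
  measurable (`[x1, x2]%classic `*` `[y1, y2]%classic : set plane) /\
  (leb2 (`[x1, x2]%classic `*` `[y1, y2]%classic) = ((x2 - x1) * (y2 - y1))%:E)%E.
Proof.
move=> x12 y12; split; first exact: measurableX.
rewrite [LHS](@product_measure1E _ _ _ _ _ leb leb)//= !lebesgue_measure_itv /= !lte_fin.
move: x12 y12; rewrite !le_eqVlt => /predU1P[->|x12]; first by rewrite ltxx subrr !mul0r mul0e.
move=> /predU1P[->|y12]; first by rewrite ltxx subrr mulr0 mule0.
by rewrite x12 y12 -!EFinD -EFinM.
Qed.

Lemma box_bounded_integrable f (M x1 x2 y1 y2 : R) : x1 <= x2 -> y1 <= y2 ->
  measurable_fun setT (f : plane -> R) -> (forall p, `|f p| <= M) ->
  (forall p, f p != 0 -> x1 <= p.1 <= x2 /\ y1 <= p.2 <= y2) ->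
  leb2.-integrable setT (fun p => (f p)%:E) /\
  \int[leb2]_p f p <= M * ((x2 - x1) * (y2 - y1)).
Proof.
move=> x12 y12 mf fM fbox; have [mB muB] := lebesgue2_box x12 y12.
have := @bounded_integrable _ _ _ leb2 _ f M mB.
rewrite muB /= ltry; apply => // p; rewrite indicE.
have [f0|/fbox[p1 p2]] := eqVneq (f p) 0.
  by rewrite f0 normr0 mulr_ge0//; exact: le_trans (fM p).
by rewrite mem_set ?mulr1//; split; rewrite /= in_itv.
Qed.

Lemma test_integrable D f : test_function D f ->
  leb2.-integrable setT (fun p => (f p)%:E).
Proof.
move=> tf; have [N N0 fN] := test_box tf; have [M M0 fM] := test_bounded tf.
have NN : - N <= N by rewrite lerNl ge0_cp// ltW.
have [] := @box_bounded_integrable f M _ _ _ _ NN NN _ fM => //.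
  by apply: continuous_measurable_fun2; apply: smooth_continuous; case: tf.
by move=> p /fN[]; rewrite !ler_norml.
Qed.

Lemma test_measurable D f : test_function D f -> measurable_fun setT (f : plane -> R).
Proof. by move=> [sf _]; apply: continuous_measurable_fun2; exact: smooth_continuous. Qed.

Lemma Rintegral_support D f : (forall p, ~ D p -> f p = 0) ->
  \int[leb2]_(p in D) f p = \int[leb2]_p f p.
Proof.
move=> fD; rewrite Rintegral_mkcond; apply: eq_Rintegral => p _.
by rewrite patchE; case: ifPn => //; rewrite notin_setE => /fD ->.
Qed.

Lemma test_eq0_outside D f p : test_function D f -> ~ D p -> f p = 0.
Proof. by move=> [_ [K [_ KD fK]]] nDp; apply: fK => /KD. Qed.

Lemma test_sqint D f : measurable (D : set plane) -> test_function D f -> sqint leb2 D f.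
Proof.
move=> mD tf; split; first exact: measurable_funTS (test_measurable tf).
have fin := integrable_lty measurableT (test_integrable (test_mul tf (proj1 tf))).
apply: le_lt_trans fin.
apply: (@le_trans _ _ (\int[leb2]_p ((f p) ^+ 2)%:E)%E).
  apply: ge0_subset_integral => //.
  - by apply/measurable_EFinP/measurable_funX; exact: test_measurable tf.
  - by move=> p _; rewrite lee_fin sqr_ge0.
by rewrite le_eqVlt; apply/orP; left; apply/eqP/eq_integral => p _; rewrite expr2.
Qed.

(** Fubini's theorem, with the variable of differentiation as the inner one: every slice integrates
    a derivative of a compactly supported function. *)
Lemma integral_pderiv_eq0 D j f : test_function D f ->
  \int[leb2]_p pderiv j f p = 0.
Proof.
move=> tf; have tdf := test_pderiv j tf; have [sf _] := tf; have [sdf _] := tdf.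
have [N N0 fN] := test_box tf; have [N' N'0 dfN'] := test_box tdf.
pose L := Num.max N N'.
rewrite /Rintegral; case: j tdf sdf dfN' => tdf sdf dfN'.
- rewrite -(integral12_prod_meas1 (test_integrable tdf)).
  rewrite (eq_integral (cst 0%E)) ?integral0// => x _; rewrite /fubini_F.
  apply: (@integral_derive_eq0 _ (fun y => f (x, y)) (fun y => pderiv true f (x, y)) L).
  + by move=> y; apply: test_slice; exact: smooth_differentiable.
  + move=> y; apply: (@continuous_comp _ _ _ (fun y : R => (x, y)) (pderiv true f)).
      exact: continuous_pairr.
    exact: smooth_continuous.
  + by move=> y /fN[_] /= h; rewrite le_max h.
  + by move=> y /dfN'[_] /= h; rewrite le_max h orbT.
- rewrite -(integral21_prod_meas1 (test_integrable tdf)).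
  rewrite (eq_integral (cst 0%E)) ?integral0// => y _; rewrite /fubini_G.
  apply: (@integral_derive_eq0 _ (fun x => f (x, y)) (fun x => pderiv false f (x, y)) L).
  + by move=> x; exact/test_slice1/smooth_differentiable.
  + move=> x; apply: (@continuous_comp _ _ _ (fun x : R => (x, y)) (pderiv false f)).
      exact: continuous_pairl.
    exact: smooth_continuous.
  + by move=> x /fN[] /= h _; rewrite le_max h.
  + by move=> x /dfN'[] /= h _; rewrite le_max h orbT.
Qed.

Lemma test_integration_by_parts D j f g : measurable (D : set plane) ->
  test_function D f -> test_function D g ->
  ip leb2 D f (pderiv j g) = - ip leb2 D (pderiv j f) g.
Proof.
move=> mD tf tg; have [sf _] := tf; have [sg _] := tg.
have tdf := test_pderiv j tf; have tdg := test_pderiv j tg.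
apply/eqP; rewrite -addr_eq0; apply/eqP; rewrite /ip -RintegralD//; last 2 first.
- by apply: sqint_mul_integrable => //; exact: test_sqint.
- by apply: sqint_mul_integrable => //; exact: test_sqint.
rewrite -[RHS](integral_pderiv_eq0 j (test_mul tf sg)).
rewrite Rintegral_support => [|p nDp]; last first.
  by rewrite (test_eq0_outside tf)// (test_eq0_outside tg)// mul0r mulr0 addr0.
apply: eq_Rintegral => p _; rewrite pderivM; try by move=> ?; exact: smooth_differentiable.
by rewrite -[RHS]/(f p * pderiv j g p + g p * pderiv j f p) [_ * g p]mulrC.
Qed.

End PlaneIntegral.

(** * The Poincare inequality on the strip *)

Lemma continuous_sqr (R : realType) (f : R -> R) (t : R) :
  {for t, continuous f} -> {for t, continuous (fun x => f x ^+ 2)}.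
Proof.
move=> cf; apply: (@continuous_comp _ _ _ f (fun x => x ^+ 2)) => //.
exact: exprn_continuous.
Qed.

Definition kappa {R : realType} (a : R) : R := pi / (2 * a).

Section PoincareStrip.
Context {R : realType}.
Variables (a : R) (ha : 0 < a).
Local Notation leb := (@lebesgue_measure R).
Local Notation leb2 := (@lebesgue2 R).
Local Notation plane := (measurableTypeR R * measurableTypeR R)%type.
Local Notation kap := (kappa a).

Lemma kappa_gt0 : 0 < kap.
Proof. by rewrite divr_gt0 ?pi_gt0// mulr_gt0. Qed.

Lemma kappa_mul : kap * a = pi / 2.
Proof. by rewrite /kappa; field; rewrite gt_eqF. Qed.

Lemma cos_scaled_gt0 t : `|t| < a -> 0 < cos (kap * t).
Proof.
move=> ta; apply: cos_gt0_pihalf; rewrite -ltr_norml normrM.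
by rewrite (gtr0_norm kappa_gt0) -kappa_mul ltr_pM2l ?kappa_gt0.
Qed.

Lemma measurable_strip : measurable (strip a : set plane).
Proof.
apply: open_measurable2.
have -> : strip a = snd @^-1` `]- a, a[%classic.
  by apply/seteqP; split=> p; rewrite /strip /= in_itv.
have /continuousP : continuous (@snd R R) by move=> p; exact: cvg_snd.
by apply; exact: interval_open.
Qed.

(* Jacobi's substitution: with T = tan (kap y),
   u'^2 - kap^2 u^2 + (kap T u^2)' = (u' + kap T u)^2. *)
Lemma slice_poincare (u du : R -> R) (b : R) : 0 < b < a ->
  (forall t : R, is_derive t 1 u (du t)) -> continuous du ->
  (forall t, u t != 0 -> `|t| <= b) -> (forall t, du t != 0 -> `|t| <= b) ->
  (0 <= \int[leb]_t (du t ^+ 2 - kap ^+ 2 * u t ^+ 2)%:E)%E.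
Proof.
(* Below a, so that the tangent is smooth on the segment; above b, so that u vanishes at both
   ends. *)
move=> /andP[b0 ba] dudt cdu ub dub; pose L := (a + b) / 2.
have bL : b < L by rewrite /L; lra.
have La : L < a by rewrite /L; lra.
have L0 : 0 < L by lra.
have inL t : t \in `[- L, L] -> `|t| < a.
  by rewrite in_itv /= -ler_norml => tL; exact: le_lt_trans tL La.
pose T t := tan (kap * t).
have cu : continuous u.
  move=> t; apply: differentiable_continuous; apply/derivable1_diffP.
  by have [] := dudt t.
have dk (t : R) : is_derive t 1 (fun t => kap * t) kap.
  by apply: is_derive_eq (is_deriveZ kap (is_derive_id t 1)) _; exact: mulr1.
have dT t : t \in `[- L, L] -> is_derive t 1 T (kap * (1 + T t ^+ 2)).
  move=> /inL ta; have c0 : cos (kap * t) != 0 by rewrite gt_eqF// cos_scaled_gt0.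
  apply: is_derive_eq (is_derive1_comp (is_derive_tan c0) (dk t)) _.
  by rewrite cos2_tan2// mulrC.
pose F t := kap * (T t * (u t * u t)).
pose h t := kap * (T t * (u t * du t + u t * du t) + u t * u t * (kap * (1 + T t ^+ 2))).
have dF t : t \in `[- L, L] -> is_derive t 1 F (h t).
  move=> tL; exact: (is_deriveZ kap (is_deriveM (dT t tL) (is_deriveM (dudt t) (dudt t)))).
have cT t : t \in `[- L, L] -> {for t, continuous T}.
  move=> tL; apply: differentiable_continuous; apply/derivable1_diffP.
  by have [] := dT t tL.
have ch : {within `[- L, L], continuous h}.
  apply: continuous_in_subspaceT => t /set_mem tL; have c := cT t tL.
  have c2 : {for t, continuous (fun t => T t ^+ 2)} by exact: continuous_sqr.
  apply: cvgMr; apply: cvgD; apply: cvgM => //.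
  - by apply: cvgD; apply: cvgM => //; [exact: cu|exact: cdu|exact: cu|exact: cdu].
  - by apply: cvgM; exact: cu.
  - by apply: cvgMr; apply: cvgD => //; exact: cvg_cst.
pose G t := du t ^+ 2 - kap ^+ 2 * u t ^+ 2.
have cG : continuous G.
  move=> t; apply: cvgB.
    by apply: continuous_sqr; exact: cdu.
  by apply: cvgMr; apply: continuous_sqr; exact: cu.
have vanish t : b < `|t| -> u t = 0 /\ du t = 0.
  move=> bt; split; apply/eqP; apply: contraT; [move/ub|move/dub]; by rewrite leNgt bt.
rewrite (@integral_segment_support _ _ L); last first.
  move=> t; apply: contraNT; rewrite -ltNge => Lt.
  by have [|-> ->] := vanish t; [exact: lt_trans Lt|rewrite expr0n/= mulr0 subr0].
have iF : (\int[leb]_(t in `[(- L)%R, L]) (h t)%:E = 0)%E.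
  rewrite (@FTC_segment _ F) ?gtrN//.
  have [uL _] : u L = 0 /\ du L = 0 by apply: vanish; rewrite gtr0_norm.
  have [uNL _] : u (- L) = 0 /\ du (- L) = 0 by apply: vanish; rewrite normrN gtr0_norm.
  by rewrite /F uL uNL !mulr0 subee.
have int_h : leb.-integrable `[- L, L] (fun t => (h t)%:E).
  by apply: continuous_compact_integrable => //; exact: segment_compact.
have int_G : leb.-integrable `[- L, L] (fun t => (G t)%:E).
  apply: continuous_compact_integrable; first exact: segment_compact.
  exact: continuous_subspaceT.
(* Adding the vanishing integral of h completes the square. *)
rewrite -[leRHS]adde0 -[X in (_ <= _ + X)%E]iF -integralD//.
apply: integral_ge0 => t _; rewrite -EFinD lee_fin.
have -> : G t + h t = (du t + kap * T t * u t) ^+ 2 by rewrite /G /h; ring.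
exact: sqr_ge0.
Qed.

Lemma poincare_test (f : R * R -> R) : test_function (strip a) f ->
  kap ^+ 2 * ip leb2 (strip a) f f <=
  ip leb2 (strip a) (pderiv true f) (pderiv true f).
Proof.
move=> tf; have tdf := test_pderiv true tf.
have [sf _] := tf; have [sdf _] := tdf.
have [b bP fb] := test_strip_box ha tf; have [b' b'P dfb] := test_strip_box ha tdf.
have mS := measurable_strip; have qf := test_sqint mS tf; have qdf := test_sqint mS tdf.
rewrite -subr_ge0 -ipZl// /ip -RintegralB//; last 2 first.
- exact: sqint_mul_integrable.
- by apply: sqint_mul_integrable => //; exact: sqintZ.
(* The integrand is itself a test function, hence integrable on the plane; this allows Fubini's
   theorem, after which every vertical slice is nonnegative. *)
pose G := pderiv true f * pderiv true f + cst (- kap ^+ 2) * (f * f).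
have tG : test_function (strip a) G.
  by apply: test_add; [exact: test_mul|apply: test_scale; exact: test_mul].
rewrite [leRHS](_ : _ = \int[leb2]_(p in strip a) G p); last first.
  by apply: eq_Rintegral => p _; rewrite /G -[RHS]/(pderiv true f p * pderiv true f p + - kap ^+ 2 * (f p * f p)); ring.
rewrite Rintegral_support; last by move=> p; exact: (test_eq0_outside tG).
apply: fine_ge0; rewrite -(integral12_prod_meas1 (test_integrable tG)).
apply: integral_ge0 => x _; rewrite /fubini_F.
rewrite [leRHS](_ : _ = \int[leb]_y
    (pderiv true f (x, y) ^+ 2 - kap ^+ 2 * f (x, y) ^+ 2)%:E)%E; last first.
  apply: eq_integral => y _; congr (_%:E).
  by rewrite /G -[LHS]/(pderiv true f (x, y) * pderiv true f (x, y) + - kap ^+ 2 * (f (x, y) * f (x, y))); ring.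
apply: (@slice_poincare (fun y => f (x, y)) (fun y => pderiv true f (x, y)) (Num.max b b')).
- by rewrite lt_max gt_max; case/andP: bP => -> ->; case/andP: b'P => _ ->.
- by move=> y; apply: test_slice; exact: smooth_differentiable.
- move=> y; apply: (@continuous_comp _ _ _ (fun y : R => (x, y)) (pderiv true f)).
    exact: continuous_pairr.
  exact: smooth_continuous.
- by move=> y /fb /= h; rewrite le_max h.
- by move=> y /dfb /= h; rewrite le_max h orbT.
Qed.

End PoincareStrip.

(** * The form domain H^1_0 *)

Section FormDomain.
Context {R : realType}.
Local Notation leb2 := (@lebesgue2 R).
Local Notation plane := (measurableTypeR R * measurableTypeR R)%type.
Variable D : set (R * R).
Hypothesis mD : measurable (D : set plane).
(* A function (index [None]) together with its gradient (indices [Some j]). *)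
Local Notation vec := (option bool -> R * R -> R).
Local Notation sqint := (sqint leb2 D).
Local Notation ip := (ip leb2 D).
Implicit Types (U V : vec) (i : option bool) (j : bool).

Definition gradient (f : R * R -> R) : vec :=
  fun i => if i is Some j then pderiv j f else f.

Definition comb (t : R) U V : vec := fun i p => U i p + t * V i p.

(** The real space H^1_0(D), as the closure of the test functions. The gradient is part of the data
    instead of being derived from the function, which makes completeness a componentwise matter;
    that it is the weak gradient is a consequence, [h10_weak_pderiv]. *)
Definition h10 U : Prop :=
  (forall i, sqint (U i)) /\
  forall e : R, 0 < e -> exists2 f, test_function D f &
    forall i, ip (fun p => gradient f i p - U i p) (fun p => gradient f i p - U i p) <= e.

Lemma gradient_sqint f i : test_function D f -> sqint (gradient f i).
Proof. by case: i => [j|] tf; apply: test_sqint => //; exact: test_pderiv. Qed.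

(** The parallelogram law, with the square of the sum dropped. *)
Lemma ip_sub_sqr_le f g : sqint f -> sqint g ->
  ip (fun p => f p - g p) (fun p => f p - g p) <= 2 * (ip f f + ip g g).
Proof.
move=> sf sg.
have e1 : ip (fun p => f p - g p) (fun p => f p - g p) = ip f f - 2 * ip f g + ip g g.
  have sfg := sqintB mD sf sg; rewrite ipBl// ![ip _ (fun p => _ - _)]ipC !ipBl//.
  by rewrite (ipC _ _ g f); ring.
have e2 : ip (fun p => f p + g p) (fun p => f p + g p) = ip f f + 2 * ip f g + ip g g.
  have sfg := sqintD mD sf sg; rewrite ipDl// ![ip _ (fun p => _ + _)]ipC !ipDl//.
  by rewrite (ipC _ _ g f); ring.
have := ip_ge0 leb2 D (fun p => f p + g p); rewrite e1 e2; lra.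
Qed.

Lemma ip_triangle f g h : sqint f -> sqint g -> sqint h ->
  ip (fun p => f p - g p) (fun p => f p - g p) <=
  2 * (ip (fun p => f p - h p) (fun p => f p - h p) +
       ip (fun p => h p - g p) (fun p => h p - g p)).
Proof.
move=> sf sg sh.
have := ip_sub_sqr_le (sqintB mD sf sh) (sqintB mD sg sh).
congr (_ <= _).
  by apply: ip_eq => p _; ring.
by congr (2 * (_ + _)); apply: eq_Rintegral => p _; ring.
Qed.

Lemma gradient_comb t f g i p : smooth f -> smooth g ->
  gradient (f + cst t * g) i p = gradient f i p + t * gradient g i p.
Proof.
move=> sf sg; case: i => [j|//] /=.
rewrite pderivD ?pderivZ// => q; apply: smooth_differentiable => //.
exact: smoothZ.
Qed.

Lemma h10_comb t U V : h10 U -> h10 V -> h10 (comb t U V).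
Proof.
move=> [sU aU] [sV aV]; split=> [i|e e0]; first exact: sqintDM.
have t1 : 0 < 1 + t ^+ 2 by rewrite ltr_pwDl// sqr_ge0.
pose e' := e / (2 * (1 + t ^+ 2)).
have e'0 : 0 < e' by rewrite divr_gt0// mulr_gt0.
have [f tf hf] := aU e' e'0; have [g tg hg] := aV e' e'0.
exists (f + cst t * g); first by apply: test_add => //; exact: test_scale.
move=> i; have [sf _] := tf; have [sg _] := tg.
have sdf := sqintB mD (gradient_sqint i tf) (sU i).
have sdg := sqintB mD (gradient_sqint i tg) (sV i).
have := ip_sub_sqr_le sdf (sqintZ mD (- t) sdg).
rewrite (@ip_eq _ _ _ leb2 D _ (fun p => gradient (f + cst t * g) i p - comb t U V i p)
  _ (fun p => gradient (f + cst t * g) i p - comb t U V i p)); last 2 first.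
- by move=> p _; rewrite gradient_comb// /comb; ring.
- by move=> p _; rewrite gradient_comb// /comb; ring.
move/le_trans; apply.
rewrite (ipZl mD)//; last exact: sqintZ.
rewrite [ip _ (fun p => - t * _)]ipC (ipZl mD)//.
have hA := hf i; have hB := hg i.
have -> : e = 2 * (e' + t ^+ 2 * e') by rewrite /e'; field; rewrite gt_eqF.
rewrite ler_pM2l// lerD// mulrA mulrNN -expr2 ler_wpM2l// sqr_ge0//.
Qed.

Lemma h10_test f : test_function D f -> h10 (gradient f).
Proof.
move=> tf; split=> [i|e e0]; first exact: gradient_sqint.
exists f => // i; rewrite (@ip_eq _ _ _ leb2 D _ (cst 0) _ (cst 0)).
- by rewrite /ip; under eq_Rintegral do rewrite mulr0; rewrite Rintegral_cst// mul0r ltW.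
- by move=> p _; rewrite subrr.
- by move=> p _; rewrite subrr.
Qed.

Lemma h10_0 : h10 (fun _ _ => 0).
Proof.
have := h10_test (test0 D); congr h10; apply/funext => -[j|]//=.
exact: pderiv_cst.
Qed.

Lemma h10_complete (U_ : nat -> vec) : (forall n, h10 (U_ n)) ->
  (forall i (e : R), 0 < e -> exists N, forall m n, (N <= m)%N -> (N <= n)%N ->
    ip (fun p => U_ m i p - U_ n i p) (fun p => U_ m i p - U_ n i p) <= e) ->
  exists U, h10 U /\ forall (e : R), 0 < e -> exists N, forall n, (N <= n)%N ->
    forall i, ip (fun p => U_ n i p - U i p) (fun p => U_ n i p - U i p) <= e.
Proof.
move=> hU cU.
have /choice[U UP] : forall i, exists u, sqint u /\ forall e : R, 0 < e -> exists N,
    forall n, (N <= n)%N ->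
    ip (fun p => U_ n i p - u p) (fun p => U_ n i p - u p) <= e.
  move=> i; apply: (sqint_complete mD (f_ := fun n => U_ n i)); last exact: cU.
  by move=> n; case: (hU n).
have conv (e : R) : 0 < e -> exists N, forall n, (N <= n)%N ->
    forall i, ip (fun p => U_ n i p - U i p) (fun p => U_ n i p - U i p) <= e.
  move=> e0; have /choice[N NP] : forall i, exists N, forall n, (N <= n)%N ->
      ip (fun p => U_ n i p - U i p) (fun p => U_ n i p - U i p) <= e.
    by move=> i; have [_] := UP i; exact.
  exists (\sum_i N i)%N => n Nn i; apply: NP; apply: leq_trans Nn.
  by rewrite (bigD1 i)//= leq_addr.
exists U; split=> //; split=> [i|e e0]; first by case: (UP i).
(* Two errors, from the sequence and from the test function close to its term, each doubled by
   [ip_triangle]. *)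
have e4 : 0 < e / 4 by rewrite divr_gt0.
have [N /(_ N (leqnn _)) NP] := conv _ e4; have [sN /(_ _ e4)[f tf hf]] := hU N.
exists f => // i; have [sUi _] := UP i.
apply: le_trans (ip_triangle (gradient_sqint i tf) sUi (sN i)) _.
have := NP i; have := hf i; set A := ip _ _; set B := ip _ _; lra.
Qed.

(** Integration by parts holds for test functions, and both sides are continuous in the H^1 norm:
    Cauchy-Schwarz bounds the square of the defect by C e for an approximation of squared accuracy
    e. *)
Lemma h10_weak_pderiv U j (g : R * R -> R) : h10 U -> test_function D g ->
  ip (U None) (pderiv j g) = - ip (U (Some j)) g.
Proof.
move=> [sU aU] tg; have sg := test_sqint mD tg.
have sdg := test_sqint mD (test_pderiv j tg).
apply/eqP; rewrite -addr_eq0; apply/eqP.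
pose C := 2 * (ip (pderiv j g) (pderiv j g) + ip g g).
apply: (@sqr_arbitrarily_small _ _ C).
  by rewrite mulr_ge0// addr_ge0// ip_ge0.
move=> e e0; have [f tf hf] := aU e e0.
have s0 := sqintB mD (gradient_sqint None tf) (sU None).
have s1 := sqintB mD (gradient_sqint (Some j) tf) (sU (Some j)).
have h0 := ip_cauchy_schwarz mD s0 sdg; have h1 := ip_cauchy_schwarz mD s1 sg.
have g0 := ip_ge0 leb2 D g; have g1 := ip_ge0 leb2 D (pderiv j g).
have k0 := ler_wpM2r g1 (hf None); have k1 := ler_wpM2r g0 (hf (Some j)).
have e0' : ip (fun p => gradient f None p - U None p) (pderiv j g) =
    ip f (pderiv j g) - ip (U None) (pderiv j g).
  exact: (ipBl mD (gradient_sqint None tf) (sU None) sdg).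
have e1' : ip (fun p => gradient f (Some j) p - U (Some j) p) g =
    ip (pderiv j f) g - ip (U (Some j)) g.
  exact: (ipBl mD (gradient_sqint (Some j) tf) (sU (Some j)) sg).
move: (le_trans h0 k0) (le_trans h1 k1); rewrite e0' e1' (test_integration_by_parts j mD tf tg) /C.
set x := ip (pderiv j f) g; set y := ip (U None) _; set z := ip (U (Some j)) _.
set G := ip g g; set G' := ip (pderiv j g) _ => l0 l1.
have := sqr_ge0 ((- x - y) - (x - z)); rewrite !expr2 in l0 l1 *; lra.
Qed.

(** Continuity of the squared norm without square roots. With d = f - g, expanding |d + s g|^2 >= 0
    and |d - s g|^2 >= 0 and dividing by s bounds the cross term 2 <d, g> by s (|g|^2 + 1) on both
    sides. *)
Lemma ip_sqr_near f g (s : R) : sqint f -> sqint g -> 0 < s ->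
  ip (fun p => f p - g p) (fun p => f p - g p) <= s ^+ 2 ->
  ip f f <= ip g g + s * (ip g g + 1) + s ^+ 2 /\
  ip g g <= ip f f + s * (ip g g + 1).
Proof.
move=> sf sg s0 h; have sd := sqintB mD sf sg.
set d := (fun p => f p - g p) in h sd *.
have E t : ip (fun p => d p + t * g p) (fun p => d p + t * g p) =
    ip d d + 2 * t * ip d g + t ^+ 2 * ip g g.
  apply: (@form_comb_sqr _ _ (fun t f g x => f x + t * g x) sqint ip) => //.
  - by move=> *; exact: sqintDM.
  - by move=> *; apply: ipC.
  - by move=> *; apply: ipDMl.
have ffE : ip f f = ip d d + 2 * ip d g + ip g g.
  rewrite -[2]mulr1 -[ip g g]mul1r -[X in X * ip g g](expr1n _ 2) -E.
  by apply: ip_eq => p _; rewrite /d mul1r subrK.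
have := ip_ge0 leb2 D (fun p => d p + s * g p); rewrite E.
have := ip_ge0 leb2 D (fun p => d p + (- s) * g p); rewrite E ffE.
have := ip_ge0 leb2 D d; move: h; rewrite !expr2 => h d0 h1 h2.
have k1 : 2 * ip d g <= s * (ip g g + 1).
  rewrite -(ler_pM2l s0); lra.
have k2 : - (2 * ip d g) <= s * (ip g g + 1).
  rewrite -(ler_pM2l s0); lra.
split; lra.
Qed.

Lemma h10_gradient_lower_bound (c : R) j : 0 <= c ->
  (forall f, test_function D f -> c * ip f f <= ip (pderiv j f) (pderiv j f)) ->
  forall U, h10 U -> c * ip (U None) (U None) <= ip (U (Some j)) (U (Some j)).
Proof.
move=> c0 hc U [sU aU]; apply/ler_addgt0Pl => e e0.
set A := ip (U None) _; set B := ip (U (Some j)) _.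
have A0 : 0 <= A by exact: ip_ge0.
have B0 : 0 <= B by exact: ip_ge0.
(* The sum of the coefficients of s in the errors; the last 1 accounts for s^2 <= s. *)
pose C := c * (A + 1) + (B + 1) + 1.
have C1 : 1 <= C by rewrite /C; have := mulr_ge0 c0 A0; lra.
pose s := Num.min 1 (e / C).
have s0 : 0 < s by rewrite lt_min ltr01 divr_gt0// (lt_le_trans ltr01).
have s1 : s <= 1 by rewrite ge_min lexx.
have sC : s * C <= e by rewrite -ler_pdivlMr ?(lt_le_trans ltr01)// ge_min lexx orbT.
have [f tf hf] := aU (s ^+ 2) (exprn_gt0 _ s0).
have [_ h0] := ip_sqr_near (gradient_sqint None tf) (sU None) s0 (hf None).
have [h1 _] := ip_sqr_near (gradient_sqint (Some j) tf) (sU (Some j)) s0 (hf (Some j)).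
have h2 := hc _ tf; have h3 := ler_wpM2l c0 h0.
have s2 : s ^+ 2 <= s by rewrite expr2 ler_piMl// ltW.
move: h1 h2 h3 sC; rewrite /= -/A -/B /C; lra.
Qed.

End FormDomain.

(** * Real and imaginary parts *)

Section ComplexSplit.
Context {R : realType}.
Local Notation leb2 := (@lebesgue2 R).
Local Notation plane := (measurableTypeR R * measurableTypeR R)%type.
Variable D : set (R * R).
Hypothesis mD : measurable (D : set plane).
Local Notation sqint := (sqint leb2 D).
Local Notation ip := (ip leb2 D).
Local Notation re u := (fun p => complex.Re (u p)).
Local Notation im u := (fun p => complex.Im (u p)).
Implicit Types (u v f : R * R -> R[i]) (g w : bool -> R * R -> R[i]).

Lemma ReB (x y : R[i]) : complex.Re (x - y) = complex.Re x - complex.Re y.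
Proof. by case: x; case: y. Qed.

Lemma ImB (x y : R[i]) : complex.Im (x - y) = complex.Im x - complex.Im y.
Proof. by case: x; case: y. Qed.

Lemma normc_sqr (x : R[i]) :
  Normc.normc x ^+ 2 = complex.Re x ^+ 2 + complex.Im x ^+ 2.
Proof. by case: x => x y /=; rewrite sqr_sqrtr// addr_ge0// sqr_ge0. Qed.

Lemma sqnorm_split u : measurable_fun D (re u) -> measurable_fun D (im u) ->
  (sqnorm D u = \int[leb2]_(p in D) ((complex.Re (u p)) ^+ 2)%:E +
               \int[leb2]_(p in D) ((complex.Im (u p)) ^+ 2)%:E)%E.
Proof.
move=> mr mi; rewrite /sqnorm -ge0_integralD//.
- by apply: eq_integral => p _; rewrite normc_sqr EFinD.
- by move=> p _; rewrite lee_fin sqr_ge0.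
- exact/measurable_EFinP/measurable_funX.
- by move=> p _; rewrite lee_fin sqr_ge0.
- exact/measurable_EFinP/measurable_funX.
Qed.

Lemma L2_split u : L2 D u <-> sqint (re u) /\ sqint (im u).
Proof.
have pos (h : R * R -> R) : (0 <= \int[leb2]_(p in D) ((h p) ^+ 2)%:E)%E.
  by apply: integral_ge0 => p _; rewrite lee_fin sqr_ge0.
split=> [[mr mi]|[[mr fr] [mi fi]]].
  rewrite sqnorm_split// => fin; split; split=> //; apply: le_lt_trans fin.
    by rewrite leeDl.
  by rewrite leeDr.
by split=> //; rewrite sqnorm_split// lte_add_pinfty.
Qed.

Lemma sqnormE u : L2 D u -> sqnorm D u = (ip (re u) (re u) + ip (im u) (im u))%:E.
Proof.
move=> /[dup] -[mr mi _] /L2_split[sr si].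
by rewrite sqnorm_split// EFinD !ip_sqrE.
Qed.

Lemma cintegral_mul u v : L2 D u -> L2 D v ->
  cintegral D (fun p => u p * v p) =
    (ip (re u) (re v) - ip (im u) (im v)) +i* (ip (re u) (im v) + ip (im u) (re v)).
Proof.
move=> /L2_split[sru siu] /L2_split[srv siv]; rewrite /cintegral; congr (_ +i* _).
- rewrite /ip -RintegralB//; try exact: sqint_mul_integrable.
  by apply: eq_Rintegral => p _; case: (u p); case: (v p).
- rewrite /ip -RintegralD//; try exact: sqint_mul_integrable.
  by apply: eq_Rintegral => p _; case: (u p); case: (v p).
Qed.

Lemma innerE u v : L2 D u -> L2 D v ->
  inner D u v = (ip (re u) (re v) + ip (im u) (im v)) +i* (ip (im u) (re v) - ip (re u) (im v)).
Proof.
move=> /L2_split[sru siu] /L2_split[srv siv]; rewrite /inner /cintegral; congr (_ +i* _).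
- rewrite /ip -RintegralD//; try exact: sqint_mul_integrable.
  by apply: eq_Rintegral => p _; case: (u p); case: (v p) => * /=; rewrite mulrN opprK.
- rewrite /ip -RintegralB//; try exact: sqint_mul_integrable.
  by apply: eq_Rintegral => p _; case: (u p); case: (v p) => * /=; rewrite mulrN addrC.
Qed.

Definition re_vec u g : option bool -> R * R -> R :=
  fun i => if i is Some j then re (g j) else re u.

Definition im_vec u g : option bool -> R * R -> R :=
  fun i => if i is Some j then im (g j) else im u.

Lemma ctest_L2 phi : ctest_function D phi -> L2 D phi.
Proof. by move=> [t1 t2]; apply/L2_split; split; apply: test_sqint. Qed.

Lemma ctest_cpderiv_L2 j phi : ctest_function D phi -> L2 D (cpderiv j phi).
Proof.
by move=> [t1 t2]; apply/L2_split; split; apply: test_sqint => //=; exact: test_pderiv.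
Qed.

Lemma L2B u v : L2 D u -> L2 D v -> L2 D (fun p => u p - v p).
Proof.
move=> /L2_split[sru siu] /L2_split[srv siv]; apply/L2_split; split.
- by apply: sqint_eq (sqintB mD sru srv) => p _; rewrite ReB.
- by apply: sqint_eq (sqintB mD siu siv) => p _; rewrite ImB.
Qed.

Lemma sqnorm_sub u v : L2 D u -> L2 D v ->
  sqnorm D (fun p => u p - v p) =
    (ip (fun p => complex.Re (u p) - complex.Re (v p)) (fun p => complex.Re (u p) - complex.Re (v p)) +
     ip (fun p => complex.Im (u p) - complex.Im (v p)) (fun p => complex.Im (u p) - complex.Im (v p)))%:E.
Proof.
move=> Lu Lv; rewrite sqnormE; last exact: L2B.
by congr (_ + _)%:E; apply: ip_eq => p _; rewrite ?ReB ?ImB.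
Qed.

(** The squared H^1 distance is a sum of six nonnegative terms, the real and imaginary parts of
    three components, so the whole controls each of them. *)
Lemma sobolev0_h10 u g : sobolev0 D u g -> h10 D (re_vec u g) /\ h10 D (im_vec u g).
Proof.
move=> [[Lu hg] [phi [tphi cphi]]].
have /L2_split[sru siu] := Lu.
have Lg j : L2 D (g j) by case: (hg j).
have sg j : sqint (re (g j)) /\ sqint (im (g j)) by apply/L2_split.
pose A n i :=
  ip (fun p => gradient (re (phi n)) i p - re_vec u g i p)
     (fun p => gradient (re (phi n)) i p - re_vec u g i p) +
  ip (fun p => gradient (im (phi n)) i p - im_vec u g i p)
     (fun p => gradient (im (phi n)) i p - im_vec u g i p).
pose r n := A n None + (A n (Some true) + A n (Some false)).
have approx (e : R) : 0 < e -> exists n, r n <= e.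
  move: cphi; rewrite (_ : (fun n => _) = EFin \o r); last first.
    apply/funext => n; rewrite big_bool /r /= !EFinD.
    rewrite (sqnorm_sub (ctest_L2 (tphi n)) Lu).
    rewrite (sqnorm_sub (ctest_cpderiv_L2 true (tphi n)) (Lg true)).
    by rewrite (sqnorm_sub (ctest_cpderiv_L2 false (tphi n)) (Lg false)).
  move=> /fine_cvgP[_ /cvgrPdist_le h] e0.
  have [N _ /(_ N (leqnn N))] := h e e0; rewrite sub0r normrN => hN.
  by exists N; apply: le_trans hN; exact: ler_norm.
have A_le n i : ip (fun p => gradient (re (phi n)) i p - re_vec u g i p)
     (fun p => gradient (re (phi n)) i p - re_vec u g i p) <= r n /\
  ip (fun p => gradient (im (phi n)) i p - im_vec u g i p)
     (fun p => gradient (im (phi n)) i p - im_vec u g i p) <= r n.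
  have A0 k : 0 <= A n k by rewrite addr_ge0 ?ip_ge0.
  have Ar : A n i <= r n.
    have := A0 None; have := A0 (Some true); have := A0 (Some false).
    by rewrite /r; case: i => [[]|]; lra.
  by split; apply: le_trans Ar; rewrite /A ?lerDl ?lerDr ip_ge0.
split; split=> [[j|]|e e0] //; try by case: (sg j).
- by have [n rn] := approx e e0; exists (re (phi n)) => [|i]; [case: (tphi n)|
    apply: le_trans rn; case: (A_le n i)].
- by have [n rn] := approx e e0; exists (im (phi n)) => [|i]; [case: (tphi n)|
    apply: le_trans rn; case: (A_le n i)].
Qed.

Lemma h10_sobolev0 u g : h10 D (re_vec u g) -> h10 D (im_vec u g) -> sobolev0 D u g.
Proof.
move=> hr hi; have [sr ar] := hr; have [si ai] := hi.
have Lu : L2 D u by apply/L2_split; split; [exact: (sr None)|exact: (si None)].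
have Lg j : L2 D (g j) by apply/L2_split; split; [exact: (sr (Some j))|exact: (si (Some j))].
have e_gt0 (n : nat) : 0 < n.+1%:R^-1 :> R by rewrite invr_gt0.
split.
  split=> // j; split=> // phi tphi; have [t1 t2] := tphi.
  rewrite (cintegral_mul Lu (ctest_cpderiv_L2 j tphi)) (cintegral_mul (Lg j) (ctest_L2 tphi)).
  have w1 t : test_function D t -> ip (re u) (pderiv j t) = - ip (re (g j)) t.
    exact: (h10_weak_pderiv mD j hr).
  have w2 t : test_function D t -> ip (im u) (pderiv j t) = - ip (im (g j)) t.
    exact: (h10_weak_pderiv mD j hi).
  rewrite /= (w1 _ t1) (w1 _ t2) (w2 _ t1) (w2 _ t2).
  by apply/eqP; rewrite eq_complex /= !opprD opprK !eqxx.
have /choice[f1 f1P] : forall n : nat, exists f : R * R -> R, test_function D f /\ forall i,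
    ip (fun p => gradient f i p - re_vec u g i p) (fun p => gradient f i p - re_vec u g i p) <= n.+1%:R^-1.
  by move=> n; have [f tf hf] := ar _ (e_gt0 n); exists f.
have /choice[f2 f2P] : forall n : nat, exists f : R * R -> R, test_function D f /\ forall i,
    ip (fun p => gradient f i p - im_vec u g i p) (fun p => gradient f i p - im_vec u g i p) <= n.+1%:R^-1.
  by move=> n; have [f tf hf] := ai _ (e_gt0 n); exists f.
pose phi n p := f1 n p +i* f2 n p.
have tphi n : ctest_function D (phi n) by split; [case: (f1P n)|case: (f2P n)].
exists phi; split=> //.
pose A n i :=
  ip (fun p => gradient (f1 n) i p - re_vec u g i p)
     (fun p => gradient (f1 n) i p - re_vec u g i p) +
  ip (fun p => gradient (f2 n) i p - im_vec u g i p)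
     (fun p => gradient (f2 n) i p - im_vec u g i p).
pose r n := A n None + (A n (Some true) + A n (Some false)).
rewrite (_ : (fun n => _) = EFin \o r); last first.
  apply/funext => n; rewrite big_bool /r /= !EFinD.
  rewrite (sqnorm_sub (ctest_L2 (tphi n)) Lu).
  rewrite (sqnorm_sub (ctest_cpderiv_L2 true (tphi n)) (Lg true)).
  by rewrite (sqnorm_sub (ctest_cpderiv_L2 false (tphi n)) (Lg false)).
apply: cvg_EFin; first by apply: nearW => n.
have A_le n i : 0 <= A n i <= 2 * n.+1%:R^-1.
  have [_ /(_ i) h1] := f1P n; have [_ /(_ i) h2] := f2P n.
  by rewrite addr_ge0 ?ip_ge0//= mulr_natl mulr2n lerD.
(* Three components, each with a real and an imaginary error of at most 1/(n+1). *)
apply: (@squeeze_cvgr _ _ _ _ (cst 0) (fun n => 6 * n.+1%:R^-1)).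
- apply: nearW => n /=; have := A_le n None; have := A_le n (Some true).
  have := A_le n (Some false); rewrite /r; move: (n.+1%:R^-1) => c.
  by move=> /andP[? ?] /andP[? ?] /andP[? ?]; apply/andP; split; lra.
- exact: cvg_cst.
- rewrite -[X in _ --> X](mulr0 6); apply: cvgMr; exact: cvg_harmonic.
Qed.

Lemma sobolev0_split u g : sobolev0 D u g <-> h10 D (re_vec u g) /\ h10 D (im_vec u g).
Proof. by split=> [|[]]; [exact: sobolev0_h10|exact: h10_sobolev0]. Qed.

End ComplexSplit.

(** * The Dirichlet Laplacian on real functions and its weak solutions *)

Section LaplacianSplit.
Context {R : realType}.
Local Notation leb2 := (@lebesgue2 R).
Local Notation plane := (measurableTypeR R * measurableTypeR R)%type.
Variable D : set (R * R).
Hypothesis mD : measurable (D : set plane).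
Local Notation sqint := (sqint leb2 D).
Local Notation ip := (ip leb2 D).
Local Notation vec := (option bool -> R * R -> R).
Local Notation re u := (fun p => complex.Re (u p)).
Local Notation im u := (fun p => complex.Im (u p)).

Definition gdot (U V : vec) : R :=
  ip (U (Some true)) (V (Some true)) + ip (U (Some false)) (V (Some false)).

Definition real_laplacian (u f : R * R -> R) : Prop :=
  sqint f /\ exists U, [/\ h10 D U, U None = u &
    forall V, h10 D V -> gdot U V = ip f (V None)].

Lemma ip0r f : ip f (fun _ => 0) = 0.
Proof. by rewrite /ip; under eq_Rintegral do rewrite mulr0; rewrite Rintegral_cst// mul0r. Qed.

(** The form has real coefficients: testing against real vectors separates the real and imaginary
    parts, and conversely the sesquilinear identity is a combination of four real ones. *)
Lemma dirichlet_laplacian_split (u f : R * R -> R[i]) :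
  dirichlet_laplacian D u f <->
  real_laplacian (re u) (re f) /\ real_laplacian (im u) (im f).
Proof.
split.
- move=> [Lf [g [sg hg]]]; have /(L2_split mD)[sf1 sf2] := Lf.
  have /(sobolev0_split mD)[h1 h2] := sg.
  have Lg j : L2 D (g j) by case: sg => [[_ h] _]; case: (h j).
  have test V : h10 D V -> gdot (re_vec u g) V = ip (re f) (V None) /\
      gdot (im_vec u g) V = ip (im f) (V None).
    move=> hV; pose v p := V None p +i* 0; pose w j p := V (Some j) p +i* 0.
    have svw : sobolev0 D v w.
      apply/(sobolev0_split mD); split.
        by rewrite (_ : re_vec v w = V)//; apply/funext => -[].
      by rewrite (_ : im_vec v w = fun _ _ => 0); [exact: h10_0|apply/funext => -[]].
    have Lv : L2 D v by case: svw => [[]].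
    have Lw j : L2 D (w j) by case: svw => [[_ h] _]; case: (h j).
    have := hg _ _ svw; rewrite big_bool /= !innerE// /=.
    rewrite !ip0r => -[]; rewrite !addr0 !subr0 => e1 e2.
    by split; rewrite /gdot /=.
  split; split=> //.
    by exists (re_vec u g); split=> // V hV; case: (test V hV).
  by exists (im_vec u g); split=> // V hV; case: (test V hV).
- move=> [[s1 [U1 [h1 u1 e1]]] [s2 [U2 [h2 u2 e2]]]].
  have Lf : L2 D f by apply/(L2_split mD).
  split=> //; pose g j p := U1 (Some j) p +i* U2 (Some j) p.
  have sg : sobolev0 D u g.
    apply/(sobolev0_split mD); split.
      by rewrite (_ : re_vec u g = U1)//; apply/funext => -[].
    by rewrite (_ : im_vec u g = U2)//; apply/funext => -[].
  exists g; split=> // v w svw.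
  have Lg j : L2 D (g j) by case: sg => [[_ h] _]; case: (h j).
  have Lv : L2 D v by case: svw => [[]].
  have Lw j : L2 D (w j) by case: svw => [[_ h] _]; case: (h j).
  have /(sobolev0_split mD)[hV1 hV2] := svw.
  have := e1 _ hV1; have := e1 _ hV2; have := e2 _ hV1; have := e2 _ hV2.
  rewrite big_bool /= !innerE// /gdot /= => <- <- <- <-.
  by apply/eqP; rewrite eq_complex /=; apply/andP; split; apply/eqP; rewrite /re_vec /im_vec /=; ring.
Qed.

Lemma gdotC U V : gdot U V = gdot V U.
Proof. by rewrite /gdot ipC [ip (U (Some false)) _]ipC. Qed.

Lemma gdot_comb t U V W : h10 D U -> h10 D V -> h10 D W ->
  gdot (comb t U V) W = gdot U W + t * gdot V W.
Proof.
by move=> [sU _] [sV _] [sW _]; rewrite /gdot /comb !ipDMl//; ring.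
Qed.

Lemma gdot_ge0 U : 0 <= gdot U U.
Proof. by rewrite addr_ge0 ?ip_ge0. Qed.

(** Below c the shifted form [B] is coercive, so the Riesz representation applies to it; the bound
    on the solution is what makes the inverse bounded. *)
Lemma real_weak_solution (x c : R) (f : R * R -> R) : x < c ->
  (forall U, h10 D U -> c * ip (U None) (U None) <= gdot U U) ->
  sqint f ->
  exists U, [/\ h10 D U,
    forall V, h10 D V -> gdot U V - x * ip (U None) (V None) = ip f (V None) &
    (c - x) ^+ 2 * ip (U None) (U None) <= ip f f].
Proof.
move=> xc coer sf; have cx : 0 < c - x by rewrite subr_gt0.
pose B U V := gdot U V - x * ip (U None) (V None).
have B_coer U : h10 D U -> (c - x) * ip (U None) (U None) <= B U U.
  by move=> /coer; rewrite /B; lra.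
have B_comb t U V W : h10 D U -> h10 D V -> h10 D W -> B (comb t U V) W = B U W + t * B V W.
  move=> hU hV hW; rewrite /B gdot_comb// /comb.
  by case: hU hV hW => [sU _] [sV _] [sW _]; rewrite ipDMl//; ring.
have B_ge0 U : h10 D U -> 0 <= B U U.
  by move=> /B_coer; apply: le_trans; rewrite mulr_ge0 ?ip_ge0// ltW.
(* Coercivity gives |u|^2 <= B / (c - x), hence |grad u|^2 = B + x |u|^2 <= (1 + |x| / (c - x)) B; K
   dominates both, so that convergence in [B] implies convergence in H^1. *)
pose K := (c - x)^-1 + 1 + `|x| / (c - x).
have xcK : 0 <= `|x| / (c - x) by rewrite divr_ge0// ltW.
have cxV : 0 < (c - x)^-1 by rewrite invr_gt0.
have K0 : 0 < K by rewrite /K; lra.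
have comp_le U i : h10 D U -> ip (U i) (U i) <= K * B U U.
  move=> hU; have h := B_coer U hU; have b := B_ge0 U hU.
  have u0 : ip (U None) (U None) <= (c - x)^-1 * B U U by rewrite mulrC ler_pdivlMr// mulrC.
  have gd : gdot U U <= B U U + `|x| / (c - x) * B U U.
    rewrite -mulrA; have := ler_wpM2l (normr_ge0 x) u0.
    have := ler_wpM2r (ip_ge0 leb2 D (U None)) (ler_norm x).
    have -> : gdot U U = B U U + x * ip (U None) (U None) by rewrite /B; ring.
    lra.
  have c0 : 0 <= (c - x)^-1 * B U U by rewrite mulr_ge0// invr_ge0 ltW.
  have c1 := mulr_ge0 xcK b.
  have i1 := ip_ge0 leb2 D (U (Some true)); have i2 := ip_ge0 leb2 D (U (Some false)).
  rewrite /K !mulrDl mul1r; move: gd; rewrite /gdot.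
  by case: i => [[]|]; lra.
have hcomb := fun t U V hU hV => @h10_comb R D mD t U V hU hV.
have cauchy_K (W : vec) (e : R) i : h10 D W -> B W W <= e / K -> ip (W i) (W i) <= e.
  move=> hW We; apply: le_trans (comp_le W i hW) _.
  by rewrite mulrC -ler_pdivlMr.
have BC U V : h10 D U -> h10 D V -> B U V = B V U.
  by move=> hU hV; rewrite /B gdotC [ip (U None) _]ipC.
have [||||u [hu uP]] := @riesz_representation R vec comb (h10 D) B hcomb BC B_comb B_ge0
    (fun V => ip f (V None)) (ip f f / (c - x)) _ (h10_0 mD).
- move=> t U V [sU _] [sV _]; rewrite ipC /comb ipDMl//.
  by rewrite [ip (U None) _]ipC [ip (V None) _]ipC.
- by rewrite divr_ge0 ?ip_ge0// ltW.
- move=> V hV; have [sV _] := hV.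
  apply: le_trans (ip_cauchy_schwarz mD sf (sV None)) _.
  rewrite -mulrA ler_wpM2l ?ip_ge0// mulrC ler_pdivlMr// mulrC; exact: B_coer.
- move=> U_ hU_ cU.
  have [|U [hU UP]] := @h10_complete R D mD U_ hU_.
  + move=> i e e0; have [|N NP] := cU (e / K); first by rewrite divr_gt0.
    exists N => m n Nm Nn; have hd := hcomb (-1) _ _ (hU_ m) (hU_ n).
    have := cauchy_K _ e i hd (NP m n Nm Nn); apply: le_trans.
    by rewrite le_eqVlt; apply/orP; left; apply/eqP; apply: ip_eq => p _; rewrite /comb mulN1r.
  + exists U; split=> // e e0.
    (* Conversely [B] is at most two derivative terms plus |x| times the squared norm. *)
    have K2 : 0 < 2 + `|x| by rewrite ltr_wpDr.
    have [|N NP] := UP (e / (2 + `|x|)); first by rewrite divr_gt0.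
    exists N => n Nn; set W := comb _ _ _.
    have hW i : ip (W i) (W i) <= e / (2 + `|x|).
      apply: le_trans (NP n Nn i); rewrite le_eqVlt; apply/orP; left; apply/eqP.
      by apply: ip_eq => p _; rewrite /W /comb mulN1r.
    rewrite /B /gdot.
    have := ler_wpM2l (normr_ge0 x) (hW None).
    have := ler_wpM2r (ip_ge0 leb2 D (W None)) (ler_norm (- x)); rewrite normrN.
    have := hW (Some true); have := hW (Some false).
    have : e / (2 + `|x|) * (2 + `|x|) = e by rewrite divfK// gt_eqF.
    move: (e / _) => e'; lra.
exists u; split=> //.
have [su _] := hu; have h1 := B_coer u hu; rewrite (uP _ hu) in h1.
(* Combined with (c - x) |u|^2 <= <f, u>, the inequality |f - (c - x) u|^2 >= 0 yields the norm
   bound. *)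
have h2 := ip_ge0 leb2 D (fun p => f p + (- (c - x)) * u None p).
rewrite (@form_comb_sqr _ _ (fun t f g x => f x + t * g x) sqint ip) in h2 => //.
- rewrite !expr2 in h2 *; have := ler_wpM2l (ltW cx) h1; lra.
- by move=> *; exact: sqintDM.
- by move=> *; apply: ipC.
- by move=> *; apply: ipDMl.
Qed.

End LaplacianSplit.

(** * Spectrum and Rayleigh quotients *)

Section SpectrumBelow.
Context {R : realType}.
Local Notation leb2 := (@lebesgue2 R).
Local Notation plane := (measurableTypeR R * measurableTypeR R)%type.
Variable D : set (R * R).
Hypothesis mD : measurable (D : set plane).
Local Notation sqint := (sqint leb2 D).
Local Notation ip := (ip leb2 D).
Local Notation vec := (option bool -> R * R -> R).
Local Notation re u := (fun p => complex.Re (u p)).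
Local Notation im u := (fun p => complex.Im (u p)).

(** The difference d of two solutions has |grad d|^2 = x |d|^2, whereas coercivity requires at least
    c |d|^2. *)
Lemma real_laplacian_shift_unique (x c : R) (f v : R * R -> R) U : x < c ->
  (forall U, h10 D U -> c * ip (U None) (U None) <= gdot D U U) ->
  sqint f -> h10 D U ->
  (forall V, h10 D V -> gdot D U V - x * ip (U None) (V None) = ip f (V None)) ->
  real_laplacian D v (fun p => f p + x * v p) ->
  {ae leb2, forall p, D p -> v p = U None p}.
Proof.
move=> xc coer sf hU eU [_ [W [hW Wv eW]]].
have hd := h10_comb mD (-1) hW hU; set d := comb (-1) W U in hd.
have [sU _] := hU; have [sW _] := hW; have [sd _] := hd.
have e1 := eW _ hd; have e2 := eU _ hd.
rewrite (ipDMl mD) -?Wv// in e1.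
have e3 : gdot D d d = x * ip (d None) (d None).
  rewrite {1}/d (gdot_comb mD)// e1 {2}/d /comb [in RHS](ipDMl mD)//.
  by move: e2; lra.
have d0 : ip (d None) (d None) = 0.
  have := coer d hd; rewrite e3 => h; apply/le_anti; rewrite ip_ge0 andbT.
  have cx : 0 < c - x by rewrite subr_gt0.
  by rewrite -(ler_pM2l cx) mulr0; lra.
have := ip_eq0_ae mD (sd None) d0; apply: filterS => p h Dp.
by have := h Dp; rewrite /d /comb -Wv; lra.
Qed.

(** At a real point the complex equation is a pair of real ones. The bounding constant compares
    squared norms, hence the exponent -2. *)
Lemma resolvent_below (c x : R) : x < c ->
  (forall U, h10 D U -> c * ip (U None) (U None) <= gdot D U U) ->
  resolvent_set D (dirichlet_laplacian D) x%:C.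
Proof.
move=> xc coer; exists ((c - x) ^- 2) => f Lf.
have /(L2_split mD)[s1 s2] := Lf.
have [U1 [h1 e1 b1]] := real_weak_solution mD xc coer s1.
have [U2 [h2 e2 b2]] := real_weak_solution mD xc coer s2.
pose u p := U1 None p +i* U2 None p.
have shiftE (v : R * R -> R[i]) :
    (re (fun p => f p + x%:C * v p)%R = (fun p => complex.Re (f p) + x * complex.Re (v p))) /\
    (im (fun p => f p + x%:C * v p)%R = (fun p => complex.Im (f p) + x * complex.Im (v p))).
  by split; apply/funext => p; case: (f p) => ? ?; case: (v p) => ? ? /=; ring.
have sU (U : option bool -> R * R -> R) : h10 D U -> sqint (U None) by case.
exists u; split.
- apply/(dirichlet_laplacian_split mD); have [-> ->] := shiftE u; split.
    split; first by apply: sqintDM => //; exact: sU.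
    exists U1; split=> // V hV; rewrite /= (ipDMl mD)//; last 2 first.
    + exact: sU.
    + exact: sU.
    by rewrite -e1//; ring.
  split; first by apply: sqintDM => //; exact: sU.
  exists U2; split=> // V hV; rewrite /= (ipDMl mD)//; last 2 first.
  + exact: sU.
  + exact: sU.
  by rewrite -e2//; ring.
- have Lu : L2 D u by apply/(L2_split mD); split; exact: sU.
  rewrite !(sqnormE mD)// -EFinM lee_fin mulrC ler_pdivlMr ?exprn_gt0 ?subr_gt0//.
  by rewrite mulrDl ![_ * (c - x) ^+ 2]mulrC lerD.
- move=> v /(dirichlet_laplacian_split mD); have [-> ->] := shiftE v => -[v1 v2].
  have a1 := real_laplacian_shift_unique xc coer s1 h1 e1 v1.
  have a2 := real_laplacian_shift_unique xc coer s2 h2 e2 v2.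
  have FF : Filter (nbhs (almost_everywhere leb2)) := ae_filter_ringOfSetsType leb2.
  apply: (filterS2 _ _ a1 a2) => p r1 r2 Dp.
  by apply/eqP; rewrite eq_complex r1 ?r2 ?eqxx.
Qed.

Lemma inf_spectrum_ge (c : R) :
  (forall U, h10 D U -> c * ip (U None) (U None) <= gdot D U U) ->
  (c%:E <= inf_spectrum D (dirichlet_laplacian D))%E.
Proof.
move=> coer; apply: le_ereal_inf_tmp => _ [x sx <-]; rewrite lee_fin leNgt.
by apply/negP => xc; apply: sx; exact: resolvent_below xc coer.
Qed.

Lemma sqint_mul_bounded (V u : R * R -> R) (v0 : R) :
  measurable_fun D (V : plane -> R) -> (forall p, `|V p| <= v0) -> sqint u ->
  sqint (fun p => V p * u p).
Proof.
move=> mV Vb su; have [mu _] := su.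
have mVu : measurable_fun D (fun p : plane => V p * u p) by exact: measurable_funM.
split=> //.
apply: le_lt_trans (integrable_lty mD (integrableZl mD (v0 ^+ 2) (sqint_sqr_integrable su))).
apply: ge0_le_integral => //.
- by move=> p _; rewrite lee_fin sqr_ge0.
- exact/measurable_EFinP/measurable_funX.
- by apply/measurable_EFinP; apply: measurable_funM; [exact: measurable_cst|exact: measurable_funX].
- move=> p _; rewrite -EFinM lee_fin exprMn ler_wpM2r ?sqr_ge0//.
  rewrite -(real_normK (num_real (V p))) lerXn2r ?nnegrE//.
  exact: le_trans (normr_ge0 _) (Vb p).
Qed.

(* The infimum m of the Rayleigh quotient belongs to the spectrum: a bounded
   solution operator w of (H - m) w = u would give, by Cauchy-Schwarz for the
   nonnegative form b = q - m, the bound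
   |u|^4 = b(w,u)^2 <= b(w,w) b(u,u) = <u,w> b(u,u) <= M |u|^2 b(u,u). *)
Lemma inf_spectrum_perturbed_le (V : R * R -> R) (c0 v0 : R) U0 :
  measurable_fun D (V : plane -> R) -> (forall p, `|V p| <= v0) ->
  h10 D U0 -> 0 < ip (U0 None) (U0 None) ->
  gdot D U0 U0 + ip (fun p => V p * U0 None p) (U0 None) <= c0 * ip (U0 None) (U0 None) ->
  (inf_spectrum D (add_potential D (dirichlet_laplacian D) V) <= c0%:E)%E.
Proof.
move=> mV Vb hU0 U0pos trial.
pose n (U : vec) := ip (U None) (U None).
pose pot (U Z : vec) := ip (fun p => V p * U None p) (Z None).
pose b (m : R) (U Z : vec) := gdot D U Z + pot U Z - m * ip (U None) (Z None).
have sV U : h10 D U -> sqint (fun p => V p * U None p).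
  by move=> [sU _]; exact: sqint_mul_bounded mV Vb (sU None).
have potC U Z : pot U Z = pot Z U by apply: eq_Rintegral => p _; ring.
have pot_comb t U W Z : h10 D U -> h10 D W -> h10 D Z ->
    pot (comb t U W) Z = pot U Z + t * pot W Z.
  move=> hU hW hZ; rewrite /pot -(ipDMl mD); try exact: sV; last by case: hZ.
  by apply: ip_eq => // p _; rewrite /comb; ring.
have b_comb m t U W Z : h10 D U -> h10 D W -> h10 D Z ->
    b m (comb t U W) Z = b m U Z + t * b m W Z.
  move=> hU hW hZ; rewrite /b (gdot_comb mD)// pot_comb// /comb.
  by case: hU hW hZ => [sU _] [sW _] [sZ _]; rewrite (ipDMl mD)//; ring.
have bC m U Z : h10 D U -> h10 D Z -> b m U Z = b m Z U.
  by move=> _ _; rewrite /b gdotC potC [ip (U None) _]ipC.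
(* The lower bounds of the form; its supremum is the infimum of the Rayleigh quotient, obtained
   without dividing by norms that may vanish. *)
pose E := [set c : R | forall U, h10 D U -> 0 <= b c U U].
have E_v0 : E (- v0).
  move=> U hU; rewrite /b mulNr opprK -addrA addr_ge0 ?gdot_ge0//.
  have [sU _] := hU.
  rewrite /pot -(ipZl mD)// -(ipDl mD)//; [|exact: sV|exact: sqintZ].
  apply: Rintegral_ge0 => p _; rewrite -mulrDl -mulrA mulr_ge0// -?expr2 ?sqr_ge0//.
  by have := Vb p; rewrite ler_norml; lra.
have E_le c : E c -> c <= c0.
  move=> /(_ _ hU0) h; rewrite -(ler_pM2r U0pos); apply: le_trans trial.
  by move: h; rewrite /b /pot; lra.
have supE : has_sup E by split; [exists (- v0)|exists c0 => c; exact: E_le].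
pose m := sup E.
have Em : E m.
  move=> U hU; have n0 : 0 <= n U by exact: ip_ge0.
  have [nU|nU] := eqVneq (n U) 0.
    by have := E_v0 U hU; rewrite /b -/(n U) nU !mulr0.
  have npos : 0 < n U by rewrite lt_neqAle eq_sym nU.
  rewrite /b subr_ge0 -ler_pdivlMr//; apply: ge_sup; first by exists (- v0).
  by move=> c /(_ U hU); rewrite /b subr_ge0 ler_pdivlMr.
apply: ge_ereal_inf; exists m%:E; last by rewrite lee_fin; apply: ge_sup => //; exists (- v0).
exists m => //= -[M hM].
(* Positive, and with M <= K^2, so that |w|^2 <= M |u|^2 gives <u, w> <= K |u|^2. *)
pose K := `|M| + 1.
have K0 : 0 < K by rewrite ltr_wpDl.
(* If m were in the resolvent set, the form would also be bounded below by m + 1/K, against the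
   choice of m. *)
suff : E (m + K^-1).
  move=> /(ub_le_sup supE.2); rewrite -/m gerDl leNgt invr_gt0 K0 //.
move=> U hU; have [sU _] := hU; pose f p := U None p +i* 0.
have Lf : L2 D f by apply/(L2_split mD); split; [exact: sU|exact: sqint0].
have [w [[Lfw /(dirichlet_laplacian_split mD)[lw li]] bw _]] := hM f Lf.
have [_ [W [hW Ww eW]]] := lw; have [sW _] := hW.
have [_ [W' [[sW' _] Ww' _]]] := li.
have Lw : L2 D w by apply/(L2_split mD); split; rewrite -?Ww -?Ww'.
have nW : n W <= M * n U.
  have := bw; rewrite !(sqnormE mD)// -EFinM lee_fin /f /= (ip0r mD) addr0.
  by apply: le_trans; rewrite /n Ww lerDl ip_ge0.
have bWZ Z : h10 D Z -> b m W Z = ip (U None) (Z None).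
  move=> hZ; have [sZ _] := hZ; rewrite /b eW//.
  rewrite (_ : (fun p => complex.Re _) =
    (fun p => (U None p + m * W None p) + (-1) * (V p * W None p))); last first.
    by rewrite Ww; apply/funext => p; rewrite /f; case: (w p) => ? ? /=; ring.
  rewrite !(ipDMl mD)//; [rewrite /pot; ring|exact: sqintDM|exact: sV].
have cs := form_cauchy_schwarz (h10_comb mD) (bC m) (b_comb m) Em hW hU.
rewrite !bWZ// in cs.
have n0 : 0 <= n U by exact: ip_ge0.
have bU := Em U hU.
have UW : ip (U None) (W None) <= K * n U.
  have := ip_cauchy_schwarz mD (sU None) (sW None).
  rewrite -/(n U) -/(n W) => h1.
  have K2 : ip (U None) (W None) ^+ 2 <= (K * n U) ^+ 2.
    apply: (le_trans h1); rewrite exprMn [_ ^+ 2 * _]mulrC expr2 -mulrA ler_wpM2l//.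
    rewrite mulrC; apply: (le_trans nW); rewrite ler_wpM2r//.
    rewrite (le_trans (ler_norm M))// /K expr2; have := normr_ge0 M; nra.
  have Kn0 : 0 <= K * n U by rewrite mulr_ge0// ltW.
  by rewrite (le_trans (ler_norm _))// -ler_sqr ?nnegrE// real_normK ?num_real.
have key : n U <= K * b m U U.
  have [nU|nU] := eqVneq (n U) 0; first by rewrite nU mulr_ge0// ltW.
  have npos : 0 < n U by rewrite lt_neqAle eq_sym nU.
  rewrite -(ler_pM2l npos) -expr2; apply: (le_trans cs).
  by rewrite mulrA [n U * K]mulrC ler_wpM2r.
have -> : b (m + K^-1) U U = b m U U - K^-1 * n U by rewrite /b /n; ring.
by rewrite subr_ge0 mulrC ler_pdivrMr// mulrC.
Qed.

End SpectrumBelow.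

(** * Smooth cutoff functions *)

Section AffineComposition.
Context {R : realType}.
Implicit Types (f g : R * R -> R) (j : bool).

Definition affine (a1 b1 c1 a2 b2 c2 : R) (p : R * R) : R * R :=
  (a1 * p.1 + b1 * p.2 + c1, a2 * p.1 + b2 * p.2 + c2).

Lemma differentiable_fst2 (p : R * R) : differentiable (fst : R * R -> R) p.
Proof. by apply: linear_differentiable => q; exact: cvg_fst. Qed.

Lemma differentiable_snd2 (p : R * R) : differentiable (snd : R * R -> R) p.
Proof. by apply: linear_differentiable => q; exact: cvg_snd. Qed.

Lemma differentiable_affine a1 b1 c1 a2 b2 c2 p :
  differentiable (affine a1 b1 c1 a2 b2 c2) p.
Proof.
have d (x y z : R) : differentiable (fun q : R * R => x * q.1 + y * q.2 + z) p.
  apply: (@differentiableD _ _ _ ((cst x * fst) + (cst y * snd)) (cst z)).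
    by apply: differentiableD; apply: differentiableM => //;
      [exact: differentiable_fst2|exact: differentiable_snd2].
  exact: differentiable_cst.
exact: differentiable_pair.
Qed.

Section FixedMap.
Variables (a1 b1 c1 a2 b2 c2 : R).
Local Notation A := (affine a1 b1 c1 a2 b2 c2).

(** The class for coinduction: since the map is affine, the chain rule has constant coefficients and
    only composes with the same map again. *)
Inductive affine_comb : (R * R -> R) -> Prop :=
| AffineAtom f : smooth f -> affine_comb (f \o A)
| AffineAdd f g : affine_comb f -> affine_comb g -> affine_comb (f + g)
| AffineScale (c : R) f : affine_comb f -> affine_comb (cst c * f).

Lemma pderiv_affine f j : smooth f ->
  pderiv j (f \o A) =
    cst (if j then b1 else a1) * (pderiv false f \o A) +
    cst (if j then b2 else a2) * (pderiv true f \o A).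
Proof.
move=> sf; apply/funext => p.
have df q : differentiable f q by exact: smooth_differentiable.
rewrite -[RHS]/((if j then b1 else a1) * pderiv false f (A p) +
  (if j then b2 else a2) * pderiv true f (A p)).
(* The image of the axis under the linear part; with it the two difference quotients coincide before
   any limit is taken. *)
pose v : R * R := (if j then b1 else a1, if j then b2 else a2).
have -> : pderiv j (f \o A) p = 'D_v f (A p).
  suff E : (fun h : R => h^-1 *: (((f \o A) \o shift p) (h *: axis j) - (f \o A) p)) =
      (fun h : R => h^-1 *: ((f \o shift (A p)) (h *: v) - f (A p))).
    by rewrite /pderiv /derive E.
  apply/funext => h /=; congr (_ *: (f _ - _)); rewrite /shift /= /affine /v /axis.
  by case: (j); congr pair; rewrite /= /GRing.scale /=; ring.
have vE : v = v.1 *: axis false + v.2 *: axis true.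
  by rewrite /axis; congr pair; rewrite /= /GRing.scale /=; ring.
by rewrite vE /pderiv !deriveE// linearD !linearZ.
Qed.

Lemma smooth_affine f : smooth f -> smooth (f \o A).
Proof.
move=> sf; apply: (@smooth_coind _ affine_comb); last exact: AffineAtom.
move=> g; elim=> {g} [g sg|g h Cg [dg hg] Ch [dh hh]|c g Cg [dg hg]]; split.
- move=> p; apply: differentiable_comp; first exact: differentiable_affine.
  exact: smooth_differentiable.
- by move=> j; rewrite pderiv_affine//; apply: AffineAdd; apply: AffineScale;
    apply: AffineAtom; exact: smooth_pderiv.
- by move=> p; exact: differentiableD.
- by move=> j; rewrite pderivD//; exact: AffineAdd.
- by move=> p; apply: differentiableM => //; exact: differentiable_cst.
- move=> j; rewrite pderivM// pderiv_cst.
  rewrite (_ : cst c * _ + _ = cst c * pderiv j g); first exact: AffineScale.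
  by apply/funext => p /=; rewrite -[LHS]/(c * pderiv j g p + g p * 0) mulr0 addr0.
Qed.

End FixedMap.

(** Functions of one variable are viewed on the plane, so that a single notion of smoothness serves
    for both. *)
Lemma lift_fst (g g' : R -> R) : (forall t : R, is_derive t 1 g (g' t)) ->
  [/\ forall p : R * R, differentiable (g \o fst) p,
      pderiv false (g \o fst) = g' \o fst & pderiv true (g \o fst) = cst 0].
Proof.
move=> dg; split=> [p||].
- apply: differentiable_comp; first exact: differentiable_fst2.
  by apply/derivable1_diffP; case: (dg p.1).
- apply/funext => p /=; have [_ <-] := dg p.1.
  suff E : (fun h : R => h^-1 *: (((g \o fst) \o shift p) (h *: axis false) - (g \o fst) p)) =
      (fun h : R => h^-1 *: ((g \o shift p.1) (h *: 1) - g p.1)).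
    by rewrite /pderiv /derive E.
  by apply/funext => h.
- apply/funext => p /=; rewrite /pderiv /derive.
  rewrite (_ : (fun h : R => _) = cst 0); first exact: lim_cst.
  by apply/funext => h /=; rewrite [h *: 0]mulr0 add0r subrr [LHS]mulr0.
Qed.

Lemma lift_snd (g g' : R -> R) : (forall t : R, is_derive t 1 g (g' t)) ->
  [/\ forall p : R * R, differentiable (g \o snd) p,
      pderiv true (g \o snd) = g' \o snd & pderiv false (g \o snd) = cst 0].
Proof.
move=> dg; split=> [p||].
- apply: differentiable_comp; first exact: differentiable_snd2.
  by apply/derivable1_diffP; case: (dg p.2).
- apply/funext => p /=; have [_ <-] := dg p.2.
  suff E : (fun h : R => h^-1 *: (((g \o snd) \o shift p) (h *: axis true) - (g \o snd) p)) =
      (fun h : R => h^-1 *: ((g \o shift p.2) (h *: 1) - g p.2)).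
    by rewrite /pderiv /derive E.
  by apply/funext => h.
- apply/funext => p /=; rewrite /pderiv /derive.
  rewrite (_ : (fun h : R => _) = cst 0); first exact: lim_cst.
  by apply/funext => h /=; rewrite [h *: 0]mulr0 add0r subrr [LHS]mulr0.
Qed.

Lemma smooth_antiderivative (g g' : R -> R) : (forall t : R, is_derive t 1 g (g' t)) ->
  smooth (g' \o fst) -> smooth (g \o fst).
Proof.
move=> dg sg'; have [d1 d2 d3] := lift_fst dg.
apply: (@smooth_coind _ (fun f => f = g \o fst \/ smooth f)); last by left.
move=> f [->|sf].
  by split=> // j; right; case: j; rewrite ?d2 ?d3//; exact: smooth_cst.
by split=> [p|j]; [exact: smooth_differentiable|right; exact: smooth_pderiv].
Qed.

Lemma smooth_swap (g : R -> R) : smooth (g \o fst) -> smooth (g \o snd).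
Proof.
move=> /(smooth_affine 0 1 0 1 0 0); congr smooth.
by apply/funext => p /=; rewrite mul0r add0r mul1r addr0.
Qed.

End AffineComposition.

Section SmoothStep.
Context {R : realType}.
Local Notation leb := (@lebesgue_measure R).

Lemma smooth_fst_continuous (g : R -> R) : smooth (g \o (fst : R * R -> R)) -> continuous g.
Proof.
move=> sg t.
apply: (@continuous_comp _ _ _ (fun x : R => (x, 0 : R)) (g \o fst)).
  exact: continuous_pairl.
exact: smooth_continuous.
Qed.

(** The integral of w from 0, a point to the left of its support, so that every t >= 1 is interior
    for the fundamental theorem of calculus; for t < 1 the function is locally zero. *)
Lemma bump_antiderivative (w : R -> R) (t0 : R) : continuous w ->
  (forall t, 0 <= w t) -> 0 < w t0 -> (forall t, w t != 0 -> 1 < t < 2) ->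
  exists (F : R -> R) (I : R), [/\ 0 < I, forall t : R, is_derive t 1 F (w t),
    forall t, t <= 1 -> F t = 0, forall t, 2 <= t -> F t = I &
    forall t, 0 <= F t <= I].
Proof.
move=> cw w0 wt0 supp.
have iw (u : R) : leb.-integrable `[0, u] (fun t => (w t)%:E).
  apply: continuous_compact_integrable; first exact: segment_compact.
  exact: continuous_subspaceT.
pose F t := \int[leb]_(s in `[0, t]) w s.
have w_lt1 s : s <= 1 -> w s = 0.
  by move=> s1; apply/eqP; apply: contraT => /supp; rewrite ltNge s1.
have w_gt2 s : 2 < s -> w s = 0.
  by move=> s1; apply/eqP; apply: contraT => /supp /andP[_]; rewrite ltNge (ltW s1).
have F0 t : t <= 1 -> F t = 0.
  move=> t1; rewrite /F /Rintegral integral_mkcond (eq_integral (cst 0%E)) ?integral0// => s _.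
  rewrite patchE; case: ifPn => // /set_mem; rewrite /= in_itv /= => /andP[_ st].
  by rewrite w_lt1// (le_trans st t1).
have FI t : 2 <= t -> F t = F 2.
  move=> t2; rewrite /F Rintegral_mkcond [RHS]Rintegral_mkcond.
  apply: eq_Rintegral => s _; rewrite !patchE !mem_setE !in_itv /=.
  have [s2|s2] := leP s 2; first by rewrite (le_trans s2 t2).
  by rewrite andbF w_gt2//; case: ifP.
have Fge0 t : 0 <= F t by apply: Rintegral_ge0.
have Fle t : F t <= F 2.
  have [/FI ->//|t2] := leP 2 t.
  rewrite /F Rintegral_mkcond [leRHS]Rintegral_mkcond; apply: le_Rintegral => //.
  - by rewrite -restrict_EFin; apply/integrable_restrict => //; rewrite setTI.
  - by rewrite -restrict_EFin; apply/integrable_restrict => //; rewrite setTI.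
  - move=> s _; rewrite !patchE !mem_setE !in_itv /=.
    have [s0|] //= := leP 0 s; case: ifP => st; case: ifP => s2 //.
    by have := le_trans st (ltW t2); rewrite s2.
have dF (t : R) : is_derive t 1 F (w t).
  have [t1|t1] := ltP t 1.
    have near0 : \forall s \near t, cst 0 s = F s.
      near=> s; rewrite F0//; apply/ltW; near: s; exact: lt_nbhsl.
    rewrite w_lt1 ?ltW//; apply: DeriveDef.
      by apply: (near_eq_derivable near0); exact: derivable_cst.
    by rewrite -(near_eq_derive _ near0) derive_cst.
  have t0' : 0 < t by exact: lt_le_trans t1.
  have tt1 : t < t + 1 by rewrite ltrDl.
  have [d e] := @continuous_FTC1_closed R w 0 t (t + 1) tt1 (iw _) t0' (cw t).
  by apply: DeriveDef; [exact: d|rewrite -derive1E; exact: e].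
exists F, (F 2); split=> //; last by move=> t; rewrite Fge0 Fle.
(* A zero total would make F vanish identically, contradicting its derivative w t0 > 0. *)
rewrite lt_neqAle Fge0 andbT eq_sym; apply/eqP => F20.
have FE : F = cst 0 by apply/funext => t; apply/le_anti; rewrite Fge0 -F20 Fle.
have [_] := dF t0; rewrite FE derive_cst => w00.
by move: wt0; rewrite -w00 ltxx.
Unshelve. all: by end_near.
Qed.

End SmoothStep.

Section Cutoff.
Context {R : realType}.
Local Notation leb2 := (@lebesgue2 R).
Local Notation plane := (measurableTypeR R * measurableTypeR R)%type.

Definition is_step (S S' : R -> R) (C : R) : Prop :=
  [/\ smooth (S \o (fst : R * R -> R)), forall t : R, is_derive t 1 S (S' t),
      forall t, 0 <= S t <= 1,
      (forall t, t <= 1 -> S t = 0) /\ (forall t, 2 <= t -> S t = 1) &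
      forall t, `|S' t| <= C /\ (S' t != 0 -> 1 < t < 2)].

(* No exponential is needed to get a smooth step: the normalized antiderivative
   of a horizontal slice of the given test function is one. *)
Lemma step_of_test (D : set (R * R)) (V : R * R -> R) : test_function D V ->
  (forall p, V p <= 0) -> (exists p, V p <> 0) -> exists S S' C, is_step S S' C.
Proof.
move=> tV V0 [[x0 y0] /eqP Vp0].
have [N N0 VN] := test_box tV; have [M M0 VM] := test_bounded tV; have [sV _] := tV.
(* The affine change sends (1, 2) onto (-2N, 2N), which contains the slice's support; x0 comes from
   3/2 + x0 / (4N). *)
pose w t := - V (4 * N * t - 6 * N, y0).
have wE : w \o (fst : R * R -> R) = cst (-1) * (V \o affine (4 * N) 0 (- (6 * N)) 0 0 y0).
  apply/funext => p; rewrite -[RHS]/(-1 * V (affine _ _ _ _ _ _ p)) mulN1r /w /= /affine.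
  by rewrite !mul0r !add0r addr0.
have sw : smooth (w \o (fst : R * R -> R)) by rewrite wE; apply: smoothZ; exact: smooth_affine.
have N4 : 4 * N != 0 by rewrite mulf_neq0 ?gt_eqF.
have [|||F [I [I0 dF F0 F1 F01]]] := @bump_antiderivative _ w (3 / 2 + x0 / (4 * N)) (smooth_fst_continuous sw).
- by move=> t; rewrite oppr_ge0.
- rewrite /w (_ : 4 * N * _ - 6 * N = x0); last by field; rewrite gt_eqF.
  by rewrite oppr_gt0 lt_neqAle Vp0 V0.
- move=> t; rewrite /w oppr_eq0 => /VN[/= + _]; rewrite ler_norml => h; apply/andP.
  by split; rewrite -(ltr_pM2l N0); lra.
have dIF (t : R) : is_derive t 1 (fun t => I^-1 * F t) (I^-1 * w t).
  exact: (@is_deriveZ _ _ _ F I^-1 t 1 (w t) (dF t)).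
exists (fun t => I^-1 * F t), (fun t => I^-1 * w t), (I^-1 * M); split.
- apply: (smooth_antiderivative dIF); exact: (smoothZ I^-1 sw).
- exact: dIF.
- by move=> t; have /andP[h0 h1] := F01 t; rewrite mulrC divr_ge0 ?(ltW I0)//= ler_pdivrMr// mul1r.
- split=> t ht; first by rewrite F0// mulr0.
  by rewrite F1// mulVf// gt_eqF.
- move=> t; split.
    by rewrite normrM gtr0_norm ?invr_gt0// ler_pM2l ?invr_gt0// /w normrN.
  rewrite mulf_eq0 negb_or => /andP[_]; rewrite /w oppr_eq0 => /VN[/= + _]; rewrite ler_norml => h.
  by apply/andP; split; rewrite -(ltr_pM2l N0); lra.
Qed.

Section CutoffFunction.
Variables (S S' : R -> R) (C : R) (L e : R).
Hypotheses (stepS : is_step S S' C) (e0 : 0 < e).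

(** In terms of the distance L - |t| to the ends, it is 0 up to e and 1 from 2e on. Starting at e
    and not at 0 leaves a compact support inside (-L, L). *)
Definition cutoff t := S ((L - t) / e) * S ((L + t) / e).

Definition cutoff' t :=
  e^-1 * (S ((L - t) / e) * S' ((L + t) / e) - S ((L + t) / e) * S' ((L - t) / e)).

Lemma smooth_cutoff : smooth (cutoff \o (fst : R * R -> R)).
Proof.
have [sS _ _ _ _] := stepS.
have -> : cutoff \o (fst : R * R -> R) =
    ((S \o (fst : R * R -> R)) \o affine (- e^-1) 0 (L / e) 0 0 0) *
    ((S \o (fst : R * R -> R)) \o affine (e^-1) 0 (L / e) 0 0 0).
  apply/funext => p; rewrite /cutoff /= -[RHS]/(S _ * S _) /affine /=.
  by congr (S _ * S _); ring.
by apply: smoothM; exact: smooth_affine.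
Qed.

Lemma is_derive_cutoff (t : R) : is_derive t 1 cutoff (cutoff' t).
Proof.
have [_ dS _ _ _] := stepS.
have d1 : is_derive t 1 (fun t => (L - t) / e) (- e^-1).
  have -> : (fun t => (L - t) / e) = (fun t : R => L / e + (- e^-1) * t).
    by apply/funext => s; ring.
  apply: is_derive_eq (is_deriveD (is_derive_cst (L / e) t 1) (is_deriveZ (- e^-1) (is_derive_id t 1))) _.
  by rewrite add0r; exact: mulr1.
have d2 : is_derive t 1 (fun t => (L + t) / e) (e^-1).
  have -> : (fun t => (L + t) / e) = (fun t : R => L / e + e^-1 * t).
    by apply/funext => s; ring.
  apply: is_derive_eq (is_deriveD (is_derive_cst (L / e) t 1) (is_deriveZ e^-1 (is_derive_id t 1))) _.
  by rewrite add0r; exact: mulr1.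
apply: is_derive_eq (is_deriveM (is_derive1_comp (dS _) d1) (is_derive1_comp (dS _) d2)) _.
by rewrite /cutoff' /= /GRing.scale /=; ring.
Qed.

Lemma cutoff_ge0_le1 t : 0 <= cutoff t <= 1.
Proof.
have [_ _ S01 _ _] := stepS.
have /andP[a0 a1] := S01 ((L - t) / e); have /andP[b0 b1] := S01 ((L + t) / e).
by rewrite mulr_ge0//= mulr_ile1.
Qed.

Lemma cutoff_support t : cutoff t != 0 -> `|t| <= L - e.
Proof.
have [_ _ _ [S0 _] _] := stepS; rewrite ler_norml /cutoff => h; apply/andP.
by split; rewrite leNgt; apply/negP => ht; move/eqP: h; apply;
  [rewrite (S0 ((L + t) / e)) ?mulr0|rewrite (S0 ((L - t) / e)) ?mul0r];
  rewrite // ler_pdivrMr//; lra.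
Qed.

Lemma cutoff_eq1 t : `|t| <= L - 2 * e -> cutoff t = 1.
Proof.
have [_ _ _ [_ S1] _] := stepS; rewrite ler_norml /cutoff => /andP[h1 h2].
by rewrite !S1 ?mulr1// ler_pdivlMr//; lra.
Qed.

Lemma cutoff'_support t : cutoff' t != 0 -> L - 2 * e <= `|t| <= L - e.
Proof.
have [_ _ _ [S0 _] S'P] := stepS.
have S'0 s : s <= 1 \/ 2 <= s -> S' s = 0.
  move=> hs; apply/eqP; apply: contraT => /(S'P s).2; case: hs => hs.
    by rewrite ltNge hs.
  by rewrite andbC ltNge hs.
move=> h; apply/andP; split.
  rewrite leNgt; apply/negP; rewrite ltr_norml => /andP[t1 t2].
  move/eqP: h; apply; rewrite /cutoff' !S'0 ?mulr0 ?subrr ?mulr0//;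
    by right; rewrite ler_pdivlMr//; lra.
rewrite ler_norml; apply/andP; split; rewrite leNgt; apply/negP => ht; move/eqP: h; apply.
- by rewrite /cutoff' (S0 ((L + t) / e)) ?(S'0 ((L + t) / e)) ?mulr0 ?mul0r ?subrr ?mulr0//;
    try left; rewrite ler_pdivrMr//; lra.
- by rewrite /cutoff' (S0 ((L - t) / e)) ?(S'0 ((L - t) / e)) ?mulr0 ?mul0r ?subrr ?mulr0//;
    try left; rewrite ler_pdivrMr//; lra.
Qed.

Lemma cutoff'_bound t : `|cutoff' t| <= 2 * C / e.
Proof.
have [_ _ S01 _ S'P] := stepS.
have /andP[a0 a1] := S01 ((L - t) / e); have /andP[b0 b1] := S01 ((L + t) / e).
have [c1 _] := S'P ((L - t) / e); have [c2 _] := S'P ((L + t) / e).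
rewrite normrM gtr0_norm ?invr_gt0// mulrC ler_pM2r ?invr_gt0//.
apply: le_trans (ler_normB _ _) _; rewrite !normrM (ger0_norm a0) (ger0_norm b0).
rewrite mulr_natl mulr2n; apply: lerD.
  by apply: le_trans c2; rewrite ler_piMl.
by apply: le_trans c1; rewrite ler_piMl.
Qed.

End CutoffFunction.

(** By continuity f exceeds half of f p0 on a box around p0, whose area is positive. *)
Lemma Rintegral_gt0 (f : R * R -> R) (p0 : R * R) : continuous f ->
  leb2.-integrable setT (fun p => (f p)%:E) -> (forall p, 0 <= f p) -> 0 < f p0 ->
  0 < \int[leb2]_p f p.
Proof.
move=> cf inf f0 fp0.
have : \forall p \near p0, f p0 / 2 < f p.
  have half : f p0 / 2 < f p0 by rewrite ltr_pdivrMr// ltr_pMr// ltr1n.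
  exact: (cf p0 _ (lt_nbhsr half)).
move=> /nbhs_ballP[r /= r0 hr].
pose x1 := p0.1 - r / 2; pose x2 := p0.1 + r / 2.
pose y1 := p0.2 - r / 2; pose y2 := p0.2 + r / 2.
have r2 : 0 < r / 2 by rewrite divr_gt0.
have x12 : x1 <= x2 by rewrite /x1 /x2; lra.
have y12 : y1 <= y2 by rewrite /y1 /y2; lra.
have [mB muB] := lebesgue2_box x12 y12; set B := (_ `*` _) in mB muB.
have fB p : B p -> f p0 / 2 <= f p.
  move=> [/=]; rewrite !in_itv /= => hx hy; apply/ltW/hr.
  by split; rewrite /ball /= ltr_distlC; rewrite /x1 /x2 /y1 /y2 in hx hy; lra.
have Bfin : (leb2 B < +oo)%E by rewrite muB ltry.
have [ih Eh] := @scaled_indic_integral R _ _ leb2 B (f p0 / 2) mB Bfin.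
apply: (@lt_le_trans _ _ (\int[leb2]_p (f p0 / 2 * \1_B p))).
  rewrite Eh muB /= !mulr_gt0 ?divr_gt0//.
    by rewrite /x1 /x2; lra.
  by rewrite /y1 /y2; lra.
apply: le_Rintegral => // p _; rewrite indicE; have [/set_mem/fB|_] := boolP (p \in B).
  by rewrite mulr1.
by rewrite mulr0.
Qed.

End Cutoff.

(** * The trial function *)

Section TrialFunction.
Context {R : realType}.
Variables (a : R) (ha : 0 < a).
Local Notation leb2 := (@lebesgue2 R).
Local Notation plane := (measurableTypeR R * measurableTypeR R)%type.
Local Notation kap := (kappa a).
Local Notation proj1 := (fst : R * R -> R).
Local Notation proj2 := (snd : R * R -> R).

Lemma is_derive_scaled (k t : R) : is_derive t 1 (fun t => k * t) k.
Proof.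
by apply: is_derive_eq (@is_deriveZ _ _ _ id k t 1 1 (is_derive_id t 1)) _; exact: mulr1.
Qed.

Lemma is_derive_trig (k c d t : R) :
  is_derive t 1 (fun t => c * cos (k * t) + d * sin (k * t))
    (d * k * cos (k * t) + (- (c * k)) * sin (k * t)).
Proof.
have dc := is_derive1_comp (is_derive_cos (k * t)) (is_derive_scaled k t).
have ds := is_derive1_comp (is_derive_sin (k * t)) (is_derive_scaled k t).
apply: is_derive_eq (is_deriveD (is_deriveZ c dc) (is_deriveZ d ds)) _.
by rewrite /GRing.scale /=; ring.
Qed.

Lemma smooth_trig (k c d : R) :
  smooth ((fun t => c * cos (k * t) + d * sin (k * t)) \o proj1).
Proof.
apply: (@smooth_coind _ (fun f => exists c d,
  f = (fun t => c * cos (k * t) + d * sin (k * t)) \o proj1)); last by exists c, d.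
move=> f [{}c [{}d ->]]; have [d1 d2 d3] := lift_fst (is_derive_trig k c d).
split=> // -[].
  by exists 0, 0; rewrite d3; apply/funext => p /=; rewrite !mul0r addr0.
by exists (d * k), (- (c * k)); rewrite d2.
Qed.

(** Mean value theorem between |t| and a, where the cosine vanishes. This linear decay offsets the
    steep cutoff near the boundary. *)
Lemma cos_kappa_le t : `|t| <= a -> `|cos (kap * t)| <= kap * (a - `|t|).
Proof.
move=> ta; have k0 := kappa_gt0 ha.
have dc (s : R) : is_derive s 1 (fun t => cos (kap * t)) (- kap * sin (kap * s)).
  apply: is_derive_eq (is_derive1_comp (is_derive_cos (kap * s)) (is_derive_scaled kap s)) _.
  by ring.
have -> : cos (kap * t) = cos (kap * `|t|).
  have [t0|t0] := leP 0 t; first by rewrite ger0_norm.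
  by rewrite ltr0_norm// mulrN cosN.
have cc : {within `[`|t|, a], continuous (fun t => cos (kap * t))}.
  apply: continuous_subspaceT => s; apply: differentiable_continuous.
  by apply/derivable1_diffP; case: (dc s).
have [c _] := MVT_segment ta (fun s _ => dc s) cc.
rewrite kappa_mul// cos_pihalf sub0r => /eqP; rewrite eqr_oppLR => /eqP ->.
rewrite normrN !normrM normrN (gtr0_norm k0) (ger0_norm (_ : 0 <= a - `|t|)) ?subr_ge0//.
by rewrite -mulrA ler_pM2l// ler_piMl ?subr_ge0// sin_max.
Qed.

Lemma test_ipE (D : set (R * R)) f g : test_function D f ->
  ip leb2 D f g = \int[leb2]_p (f p * g p).
Proof.
by move=> tf; apply: Rintegral_support => p nDp; rewrite (test_eq0_outside tf)// mul0r.
Qed.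

Lemma test_RintegralD (D : set (R * R)) f g : test_function D f -> test_function D g ->
  \int[leb2]_p (f + g) p = \int[leb2]_p f p + \int[leb2]_p g p.
Proof. by move=> tf tg; rewrite -RintegralD//; [exact: test_integrable tf|exact: test_integrable tg]. Qed.

Lemma test_RintegralZ (D : set (R * R)) c f : test_function D f ->
  \int[leb2]_p (cst c * f) p = c * \int[leb2]_p f p.
Proof. by move=> tf; rewrite -RintegralZl//; exact: test_integrable tf. Qed.

Section FixedCutoff.
Variables (S S' : R -> R) (C r e : R).
Hypotheses (stepS : is_step S S' C) (r0 : 0 < r) (e0 : 0 < e) (ea : 2 * e <= a).

Let cosy : R * R -> R := (fun t => cos (kap * t)) \o proj2.
Let siny : R * R -> R := (fun t => sin (kap * t)) \o proj2.
(** The parameters 3r and r make it 1 for |x| <= r and 0 for |x| >= 2r. *)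
Let chi : R * R -> R := cutoff S (3 * r) r \o proj1.
Let dchi : R * R -> R := cutoff' S S' (3 * r) r \o proj1.
Let eta : R * R -> R := cutoff S a e \o proj2.
Let deta : R * R -> R := cutoff' S S' a e \o proj2.

Definition trial : R * R -> R := cosy * (chi * eta).

Let cosy_lift : [/\ forall p, differentiable cosy p,
  pderiv true cosy = cst (- kap) * siny & pderiv false cosy = cst 0].
Proof.
have [] := @lift_snd R (fun t => cos (kap * t)) (fun t => - kap * sin (kap * t)).
  move=> t; apply: is_derive_eq (is_derive1_comp (is_derive_cos (kap * t)) (is_derive_scaled kap t)) _.
  by ring.
by move=> d1 d2 d3; split.
Qed.

Let siny_lift : [/\ forall p, differentiable siny p,
  pderiv true siny = cst kap * cosy & pderiv false siny = cst 0].
Proof.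
have [] := @lift_snd R (fun t => sin (kap * t)) (fun t => kap * cos (kap * t)).
  move=> t; apply: is_derive_eq (is_derive1_comp (is_derive_sin (kap * t)) (is_derive_scaled kap t)) _.
  by ring.
by move=> d1 d2 d3; split.
Qed.

Let smooth_cosy : smooth cosy.
Proof.
have := smooth_swap (smooth_trig kap 1 0); congr smooth.
by apply/funext => p /=; rewrite mul1r mul0r addr0.
Qed.

Let smooth_siny : smooth siny.
Proof.
have := smooth_swap (smooth_trig kap 0 1); congr smooth.
by apply/funext => p /=; rewrite mul1r mul0r add0r.
Qed.

Let chi_lift : [/\ forall p, differentiable chi p,
  pderiv false chi = dchi & pderiv true chi = cst 0].
Proof. exact: lift_fst (is_derive_cutoff (3 * r) r stepS). Qed.

Let eta_lift : [/\ forall p, differentiable eta p,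
  pderiv true eta = deta & pderiv false eta = cst 0].
Proof. exact: lift_snd (is_derive_cutoff a e stepS). Qed.

Let smooth_chi : smooth chi := smooth_cutoff (3 * r) r stepS.
Let smooth_eta : smooth eta := smooth_swap (smooth_cutoff a e stepS).

Lemma trial_box p : (chi * eta) p != 0 -> `|p.1| <= 2 * r /\ `|p.2| <= a - e.
Proof.
rewrite -[(chi * eta) p]/(chi p * eta p) mulf_eq0 negb_or => /andP[].
move=> /(cutoff_support stepS r0) h1 /(cutoff_support stepS e0) h2; split=> //.
by apply: le_trans h1 _; lra.
Qed.

Lemma test_chi_eta : test_function (strip a) (chi * eta).
Proof.
split; first exact: smoothM.
exists (`[- (2 * r), 2 * r]%classic `*` `[- (a - e), a - e]%classic); split.
- by apply: compact_setX; exact: segment_compact.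
- move=> p [_ hp]; have : `|p.2| <= a - e by move: hp; rewrite /= in_itv /= -ler_norml.
  by rewrite /strip /= -ltr_norml => /le_lt_trans; apply; rewrite ltrBlDr ltrDl.
- move=> p nK; apply/eqP; apply: contraT => /trial_box[h1 h2]; exfalso; apply: nK.
  by split; rewrite /= in_itv /= -ler_norml.
Qed.

Lemma test_trial : test_function (strip a) trial.
Proof. by rewrite /trial mulrC; apply: test_mul => //; exact: test_chi_eta. Qed.

Lemma pderiv_trial_x : pderiv false trial = cosy * (dchi * eta).
Proof.
have [c1 c2 c3] := cosy_lift; have [x1 x2 x3] := chi_lift; have [y1 y2 y3] := eta_lift.
have dce q : differentiable (chi * eta) q by exact: differentiableM.
rewrite (pderivM false c1 dce) (pderivM false x1 y1) c3 x2 y3; apply/funext => p.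
rewrite -[LHS]/(cosy p * (chi p * 0 + eta p * dchi p) + (chi p * eta p) * 0).
rewrite -[RHS]/(cosy p * (dchi p * eta p)).
by move: (cosy p) (chi p) (eta p) (dchi p) => *; ring.
Qed.

Lemma pderiv_trial_y :
  pderiv true trial = cst (- kap) * siny * (chi * eta) + cosy * (chi * deta).
Proof.
have [c1 c2 c3] := cosy_lift; have [x1 x2 x3] := chi_lift; have [y1 y2 y3] := eta_lift.
have dce q : differentiable (chi * eta) q by exact: differentiableM.
rewrite (pderivM true c1 dce) (pderivM true x1 y1) c2 x3 y2; apply/funext => p.
rewrite -[LHS]/(cosy p * (chi p * deta p + eta p * 0) + (chi p * eta p) * (- kap * siny p)).
rewrite -[RHS]/(- kap * siny p * (chi p * eta p) + cosy p * (chi p * deta p)).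
by move: kap (cosy p) (siny p) (chi p) (eta p) (deta p) => *; ring.
Qed.

(* The ground state substitution phi = cos(kap y) psi turns
   |phi_y|^2 - kap^2 phi^2 into cos^2 |psi_y|^2 up to a y-derivative. *)
Lemma trial_ground_state :
  \int[leb2]_p (pderiv true trial p * pderiv true trial p) =
  kap ^+ 2 * \int[leb2]_p (trial p * trial p) +
  \int[leb2]_p ((cosy p * (chi p * deta p)) ^+ 2).
Proof.
(* With psi = chi eta, expanding phi_y^2 - kap^2 phi^2 leaves cos^2 psi_y^2 minus kap times the
   y-derivative of sin cos psi^2. *)
pose P := (siny * cosy) * ((chi * eta) * (chi * eta)).
have tce := test_chi_eta; have [sce _] := tce.
have tP : test_function (strip a) P.
  rewrite /P mulrC; apply: test_mul; first exact: test_mul.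
  exact: smoothM.
have dP p : pderiv true P p = kap * (cosy p ^+ 2 - siny p ^+ 2) * (chi p * eta p) ^+ 2 +
    2 * siny p * cosy p * (chi p ^+ 2 * eta p * deta p).
  have [c1 c2 _] := cosy_lift; have [s1 s2 _] := siny_lift.
  have [x1 _ x3] := chi_lift; have [y1 y2 _] := eta_lift.
  have dce q : differentiable (chi * eta) q by exact: differentiableM.
  have dsc q : differentiable (siny * cosy) q by exact: differentiableM.
  have dcece q : differentiable ((chi * eta) * (chi * eta)) q by exact: differentiableM.
  rewrite (pderivM true dsc dcece) (pderivM true dce dce) (pderivM true x1 y1) (pderivM true s1 c1).
  rewrite c2 s2 x3 y2.
  rewrite -[LHS]/(siny p * cosy p *
     ((chi p * eta p) * (chi p * deta p + eta p * 0) + (chi p * eta p) * (chi p * deta p + eta p * 0)) +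
     (chi p * eta p) * (chi p * eta p) * (siny p * (- kap * siny p) + cosy p * (kap * cosy p))).
  by move: kap (cosy p) (siny p) (chi p) (eta p) (deta p) => *; ring.
have tt := test_trial; have [st _] := tt.
have tdt := test_pderiv true tt; have [sdt _] := tdt.
have tdP := test_pderiv true tP.
pose T2 := pderiv true trial * pderiv true trial + cst (- kap ^+ 2) * (trial * trial)
  + cst kap * pderiv true P.
have t1 : test_function (strip a) (pderiv true trial * pderiv true trial) by exact: test_mul.
have t2 : test_function (strip a) (trial * trial) by exact: test_mul.
have t3 : test_function (strip a) (cst (- kap ^+ 2) * (trial * trial)) by exact: test_scale.
have t4 : test_function (strip a) (cst kap * pderiv true P) by exact: test_scale.
have T2E p : T2 p = (cosy p * (chi p * deta p)) ^+ 2.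
  rewrite -[LHS]/(pderiv true trial p * pderiv true trial p +
    - kap ^+ 2 * (trial p * trial p) + kap * pderiv true P p) dP pderiv_trial_y.
  rewrite -[(_ + _) p]/(- kap * siny p * (chi p * eta p) + cosy p * (chi p * deta p)).
  rewrite -[trial p]/(cosy p * (chi p * eta p)).
  by move: kap (cosy p) (siny p) (chi p) (eta p) (deta p) => *; ring.
have <- : \int[leb2]_p T2 p = \int[leb2]_p ((cosy p * (chi p * deta p)) ^+ 2).
  by apply: eq_Rintegral => p _; rewrite T2E.
rewrite (test_RintegralD (test_add t1 t3) t4) (test_RintegralD t1 t3).
rewrite (test_RintegralZ _ t2) (test_RintegralZ _ tdP) (integral_pderiv_eq0 true tP).
rewrite -[X in _ = _ * X + _]/(\int[leb2]_p (trial * trial) p).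
rewrite -[LHS]/(\int[leb2]_p (pderiv true trial * pderiv true trial) p).
by ring.
Qed.

(** The slope is at most 2C / r on a box of area 4r times 2a. *)
Lemma trial_x_energy :
  \int[leb2]_p (pderiv false trial p * pderiv false trial p) <= 32 * C ^+ 2 * a / r.
Proof.
have r2 : - (2 * r) <= 2 * r by rewrite ge0_cp// mulr_ge0// ltW.
have aa : - a <= a by rewrite ge0_cp// ltW.
have tdt := test_pderiv false test_trial; have [sdt _] := tdt.
have C0 : 0 <= C.
  by have [_ _ _ _ /(_ 0)[h _]] := stepS; exact: le_trans (normr_ge0 _) h.
have [] := @box_bounded_integrable R (pderiv false trial * pderiv false trial)
  ((2 * C / r) ^+ 2) _ _ _ _ r2 aa.
- by apply: continuous_measurable_fun2; apply: smooth_continuous; exact: smoothM.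
- move=> p; rewrite -[(_ * _) p]/(pderiv false trial p * pderiv false trial p).
  rewrite -expr2 ger0_norm ?sqr_ge0// -(real_normK (num_real (pderiv _ _ _))).
  rewrite lerXn2r ?nnegrE// ?divr_ge0 ?mulr_ge0 ?(ltW r0)// pderiv_trial_x.
  rewrite -[(_ * _) p]/(cosy p * (dchi p * eta p)) (normrM (cosy p)) (normrM (dchi p)).
  have b1 := cutoff'_bound (3 * r) stepS r0 p.1.
  have /andP[b2 b3] := cutoff_ge0_le1 a e stepS p.2.
  have b4 : `|cosy p| <= 1 by exact: cos_max.
  apply: le_trans b1; rewrite -/(dchi p) mulrCA -[leRHS]mulr1 ler_wpM2l// mulr_ile1//.
  by rewrite -/(eta p) ger0_norm.
- move=> p; rewrite -[(_ * _) p]/(pderiv false trial p * pderiv false trial p).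
  rewrite pderiv_trial_x mulf_eq0 orbb -[(_ * _) p]/(cosy p * (dchi p * eta p)).
  rewrite (mulf_eq0 (cosy p)) (mulf_eq0 (dchi p)) !negb_or => /and3P[_ h1 h2].
  have /andP[_ k1] := cutoff'_support stepS r0 h1.
  have k2 := cutoff_support stepS e0 h2.
  rewrite -!ler_norml; split; first by apply: le_trans k1 _; lra.
  by apply: le_trans k2 _; rewrite gerBl ltW.
move=> _; congr (_ <= _); by field; rewrite gt_eqF.
Qed.

(** On the two layers, of total area 16 r e, the cosine is at most 2 kap e and the slope of [eta] at
    most 2C / e; e cancels in the product, bounded by 4 kap C. *)
Lemma trial_y_energy :
  \int[leb2]_p ((cosy p * (chi p * deta p)) ^+ 2) <= 256 * (kap * C) ^+ 2 * r * e.
Proof.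
have r2 : - (2 * r) <= 2 * r by rewrite ge0_cp// mulr_ge0// ltW.
have e2 : a - 2 * e <= a by rewrite gerBl mulr_ge0// ltW.
have e2' : - a <= - (a - 2 * e) by rewrite lerN2.
have k0 := kappa_gt0 ha.
have C0 : 0 <= C.
  by have [_ _ _ _ /(_ 0)[h _]] := stepS; exact: le_trans (normr_ge0 _) h.
have [mB1 muB1] := lebesgue2_box r2 e2; have [mB2 muB2] := lebesgue2_box r2 e2'.
set B1 := (_ `*` _) in mB1 muB1; set B2 := (_ `*` _) in mB2 muB2.
have mB : measurable (B1 `|` B2 : set plane) by exact: measurableU.
have muB : (leb2 (B1 `|` B2) <= (16 * r * e)%:E)%E.
  rewrite (_ : 16 * r * e = (2 * r - - (2 * r)) * (a - (a - 2 * e)) +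
    (2 * r - - (2 * r)) * (- (a - 2 * e) - - a)); last by ring.
  by rewrite EFinD -muB1 -muB2; exact: measureU2.
have finB : (leb2 (B1 `|` B2) < +oo)%E by apply: le_lt_trans muB _; rewrite ltry.
have sdeta : smooth deta by have [_ <- _] := eta_lift; exact: smooth_pderiv.
have [|p|_ h] := @bounded_integrable R _ _ leb2 (B1 `|` B2)
    (fun p => (cosy p * (chi p * deta p)) ^+ 2) ((4 * kap * C) ^+ 2) mB finB.
- apply: measurable_funX; apply: continuous_measurable_fun2; apply: smooth_continuous.
  exact: smoothM smooth_cosy (smoothM smooth_chi sdeta).
- rewrite ger0_norm ?sqr_ge0//.
  have [d0|dp] := eqVneq (deta p) 0.
    by rewrite d0 !mulr0 expr0n/= mulr_ge0 ?sqr_ge0.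
  have [c0|cp] := eqVneq (chi p) 0.
    by rewrite c0 mul0r mulr0 expr0n/= mulr_ge0 ?sqr_ge0.
  have /andP[k1 k2] := cutoff'_support stepS e0 dp.
  have k3 : `|p.1| <= 2 * r by apply: le_trans (cutoff_support stepS r0 cp) _; lra.
  have k4 : `|p.2| <= a by apply: le_trans k2 _; rewrite gerBl ltW.
  have Bp : (B1 `|` B2) p.
    have hx : p.1 \in `[- (2 * r), 2 * r] by rewrite in_itv /= -ler_norml.
    have [p2|p2] := leP 0 p.2; [left|right]; split; rewrite //= in_itv /=.
      by move: k1 k4; rewrite ger0_norm// => -> ->.
    by move: k1 k4; rewrite ltr0_norm// lerNr => -> ; rewrite lerNl => ->.
  rewrite indicE mem_set// mulr1 -(real_normK (num_real (cosy p * (chi p * deta p)))).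
  have kC : 0 <= 4 * kap * C by rewrite mulr_ge0// mulr_ge0// ltW.
  rewrite lerXn2r ?nnegrE//.
  rewrite (normrM (cosy p)) (normrM (chi p)).
  have b1 : `|deta p| <= 2 * C / e by exact: cutoff'_bound.
  have b2 : `|chi p| <= 1.
    by have /andP[x0 x1] := cutoff_ge0_le1 (3 * r) r stepS p.1; rewrite ger0_norm.
  have b3 : `|cosy p| <= kap * (2 * e).
    apply: le_trans (cos_kappa_le k4) _; rewrite ler_pM2l//; move: k1; lra.
  have b4 : `|chi p| * `|deta p| <= 2 * C / e.
    by apply: le_trans b1; rewrite ler_piMl.
  apply: le_trans (ler_pM _ _ b3 b4) _; rewrite ?mulr_ge0//.
  rewrite le_eqVlt; apply/orP; left; apply/eqP; field; rewrite gt_eqF//.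
apply: le_trans h _.
have -> : 256 * (kap * C) ^+ 2 * r * e = (4 * kap * C) ^+ 2 * (16 * r * e) by ring.
by apply: ler_wpM2l; [exact: sqr_ge0|rewrite -lee_fin fineK// ge0_fin_numE].
Qed.

Lemma trial_eq_cos p : `|p.1| <= r -> `|p.2| <= a - 2 * e -> trial p = cos (kap * p.2).
Proof.
move=> p1 p2; rewrite -[LHS]/(cosy p * (chi p * eta p)) /chi /eta /=.
rewrite (cutoff_eq1 stepS r0) ?(cutoff_eq1 stepS e0)//; first by rewrite !mulr1.
by apply: le_trans p1 _; lra.
Qed.

End FixedCutoff.

Lemma exists_trial (V : R * R -> R) : test_function (strip a) V ->
  (forall p, V p <= 0) -> (exists p, V p <> 0) ->
  exists f, [/\ test_function (strip a) f, 0 < \int[leb2]_p (f p * f p) &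
    \int[leb2]_p (pderiv false f p * pderiv false f p) +
    \int[leb2]_p (pderiv true f p * pderiv true f p) +
    \int[leb2]_p (V p * f p * f p) < kap ^+ 2 * \int[leb2]_p (f p * f p)].
Proof.
move=> tV V0 Vn0; have [S [S' [C stepS]]] := step_of_test tV V0 Vn0.
have [p0 /eqP Vp0] := Vn0; have [sV _] := tV.
have [N N0 VN] := test_box tV; have [b /andP[b0 ba] Vb] := test_strip_box ha tV.
have cos_smooth : smooth ((fun t => cos (kap * t)) \o proj2).
  have := smooth_swap (smooth_trig kap 1 0); congr smooth.
  by apply/funext => p /=; rewrite mul1r mul0r addr0.
pose cosy : R * R -> R := (fun t => cos (kap * t)) \o proj2.
(* Its integral v > 0 is the gain from the potential, to be weighed against the two cutoff
   energies. *)
pose W := cst (-1) * (V * (cosy * cosy)).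
have tW : test_function (strip a) W.
  by apply: test_scale; apply: test_mul => //; exact: smoothM.
have WE p : W p = - V p * cos (kap * p.2) ^+ 2.
  by rewrite -[LHS]/(-1 * (V p * (cosy p * cosy p))) /cosy /=; ring.
have cosp0 : 0 < cos (kap * p0.2).
  by apply: (cos_scaled_gt0 ha); apply: le_lt_trans ba; exact: Vb.
have [sW _] := tW.
pose v := \int[leb2]_p W p.
have v0 : 0 < v.
  apply: (@Rintegral_gt0 _ _ p0); first exact: smooth_continuous.
  - exact: test_integrable tW.
  - by move=> p; rewrite WE mulr_ge0 ?sqr_ge0// oppr_ge0.
  - by rewrite WE mulr_gt0 ?exprn_gt0// oppr_gt0 lt_neqAle Vp0 V0.
pose c1 := 32 * C ^+ 2 * a; have c10 : 0 <= c1 by exact: mulr_ge0 (mulr_ge0 (ler0n _ _) (sqr_ge0 C)) (ltW ha).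
(* At least N, so that the x-cutoff is 1 on the support of V, and large enough for the x-energy c1 /
   r to be at most v / 4. *)
pose r := Num.max N (4 * (c1 + 1) / v).
have r0 : 0 < r by rewrite lt_max N0.
have rN : N <= r by rewrite le_max lexx.
have E1 : c1 / r <= v / 4.
  rewrite ler_pdivrMr//.
  have : 4 * (c1 + 1) / v <= r by rewrite le_max lexx orbT.
  rewrite ler_pdivrMr//; move: c10; lra.
pose c2 := 256 * (kap * C) ^+ 2 * r.
have c20 : 0 <= c2 by exact: mulr_ge0 (mulr_ge0 (ler0n _ _) (sqr_ge0 _)) (ltW r0).
(* The first bound keeps the layers off the support of V; the second makes the y-energy c2 e at most
   v / 4, where c2 contains r. *)
pose e := Num.min ((a - b) / 2) (v / (4 * (c2 + 1))).
have c21 : 0 < 4 * (c2 + 1) by rewrite mulr_gt0// ltr_wpDl.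
have e0 : 0 < e by rewrite lt_min !divr_gt0// subr_gt0.
have eb : e <= (a - b) / 2 by rewrite ge_min lexx.
have E2 : c2 * e <= v / 4.
  have : e <= v / (4 * (c2 + 1)) by rewrite ge_min lexx orbT.
  by rewrite ler_pdivlMr//; have := e0; lra.
have ab : b <= a - 2 * e by lra.
have ea : 2 * e <= a by lra.
pose f := trial S r e.
have fE p : V p != 0 -> f p = cos (kap * p.2).
  move=> Vp; apply: (trial_eq_cos stepS) => //.
    by apply: le_trans rN; have [] := VN p Vp.
  by apply: le_trans ab; exact: Vb.
have tf : test_function (strip a) f by exact: (test_trial stepS r0 e0).
have [sf _] := tf.
exists f; split=> //.
  apply: (@Rintegral_gt0 _ (f * f) p0).
  - by apply: smooth_continuous; exact: smoothM.
  - exact: (test_integrable (test_mul tf sf)).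
  - by move=> p; exact: sqr_ge0.
  - by rewrite -[(f * f) p0]/(f p0 * f p0) fE// mulr_gt0.
have Vv : \int[leb2]_p (V p * f p * f p) = - v.
  rewrite -mulN1r -(test_RintegralZ (-1) tW); apply: eq_Rintegral => p _.
  rewrite -[RHS]/(-1 * W p) WE; have [->|Vp] := eqVneq (V p) 0; first by rewrite !(mul0r, oppr0, mulr0).
  by rewrite fE//; ring.
move: (trial_x_energy stepS r0 e0) (trial_y_energy stepS r0 e0).
move: (trial_ground_state stepS r0 e0); rewrite -/f -/c1 -/c2 Vv => -> h1 h2.
(* The cutoffs cost at most v / 2 in all, the potential gains v. *)
move: h1 h2 E1 E2 v0; lra.
Qed.

End TrialFunction.

(** * Separation of the two infima *)

Theorem proposition4p2 (R : realType) (a : R) (ha : 0 < a)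
    (V : R * R -> R) (hV : test_function (strip a) V)
    (V_le0 : forall p, V p <= 0) (V_neq0 : exists p, V p <> 0) :
  (inf_spectrum (strip a)
     (add_potential (strip a) (dirichlet_laplacian (strip a)) V)
   < inf_spectrum (strip a) (dirichlet_laplacian (strip a)))%E.
Proof.
have mS := measurable_strip a.
have [f [tf n0 Q_lt]] := exists_trial ha hV V_le0 V_neq0.
have [sf _] := tf; have [sV _] := hV.
set n := (X in 0 < X) in n0 Q_lt.
set q := (X in X < _) in Q_lt.
have [M _ VM] := test_bounded hV.
(* The Rayleigh quotient of the trial function lies strictly between the two sides. *)
apply: (@le_lt_trans _ _ (q / n)%:E).
  apply: (inf_spectrum_perturbed_le mS _ VM (h10_test mS tf)).
  - exact: measurable_funTS (test_measurable hV).
  - by rewrite /gradient (test_ipE _ tf).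
  - rewrite /gdot /gradient (test_ipE f tf) -/n divfK ?gt_eqF//.
    rewrite (test_ipE _ (test_pderiv true tf)) (test_ipE _ (test_pderiv false tf)).
    have := test_ipE f (test_mul hV sf); rewrite /ip => ->.
    by rewrite /q [X in X + _ <= _]addrC.
apply: (@lt_le_trans _ _ (kappa a ^+ 2)%:E).
  by rewrite lte_fin ltr_pdivrMr.
(* The y-derivative alone gives the bound; the x-derivative contributes a nonnegative term. *)
apply: (inf_spectrum_ge mS) => U hU; rewrite /gdot.
have := h10_gradient_lower_bound mS (sqr_ge0 _) (poincare_test ha) hU.
by move/le_trans; apply; rewrite lerDl ip_ge0.
Qed.
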